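(* Let $\sigma>0$ be fixed and let $(p_n)$ be a sequence of integers with $1\le p_n\le n$, $p_n\to\infty$ and $p_n=o(n)$ as $n\to\infty$. Suppose we observe an $n$-dimensional vector $Y\sim\mathcal{N}(\theta_0,\sigma^2I_n)$ and use $T_{\widehat\tau}(Y)$ as estimator of $\theta_0$, where $\widehat\tau=\widehat\tau(Y)\in(0,1)$ is an estimator. Suppose that for $\tau=\frac{p_n}{n}$ or for $\tau=\frac{p_n}{n}\sqrt{\log(n/p_n)}$ the following two conditions hold, with constants in $\lesssim$ that do not depend on $\theta_0\in\ell_0[p_n]$: 1. $\mathbb{P}_{\theta_0}(\widehat\tau>c\tau)\lesssim\frac{p_n}{n}$ for a constant $c\ge1$ such that $\tau\le\frac1c$; 2. there exists a function $g:\mathbb{N}\times\mathbb{N}\to(0,1)$ such that $\widehat\tau\ge g(n,p_n)$ with probability one and $-\log(g(n,p_n))\,\mathbb{P}_{\theta_0}(\widehat\tau\le\tau)\lesssim\log(n/p_n)$. Then, as $n\to\infty$, $$\sup_{\theta_0\in\ell_0[p_n]}\mathbb{E}_{\theta_0}\|T_{\widehat\tau}(Y)-\theta_0\|^2\asymp p_n\log\frac{n}{p_n}.$$ If $\widehat\tau$ satisfies only condition 1 (condition 2 is not assumed), then with $\widetilde\tau=\sup\{\frac1n,\widehat\tau\}$, $$\sup_{\theta_0\in\ell_0[p_n]}\mathbb{E}_{\theta_0}\|T_{\widetilde\tau}(Y)-\theta_0\|^2\lesssim p_n\log n.$$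
   Context: $\ell_0[p_n]:=\{\theta\in\mathbb{R}^n:\#\{1\le i\le n:\theta_i\ne 0\}\le p_n\}$; $\|\cdot\|$ is the Euclidean norm on $\mathbb{R}^n$; $\mathbb{P}_{\theta_0},\mathbb{E}_{\theta_0}$ refer to $Y\sim\mathcal{N}(\theta_0,\sigma^2I_n)$. $A_n\lesssim B_n$ means there is a constant $C>0$ independent of $n$ with $A_n\le CB_n$ (for all sufficiently large $n$). $A_n\asymp B_n$ means $0<\liminf_{n\to\infty}A_n/B_n\le\limsup_{n\to\infty}A_n/B_n<\infty$. Horseshoe prior with fixed parameter $\tau>0$: the pairs $(\lambda_i,\theta_i)$, $i=1,\dots,n$, are independent, $\lambda_i$ has the standard half-Cauchy distribution $C^+(0,1)$ on $(0,\infty)$, and $\theta_i\mid\lambda_i\sim\mathcal{N}(0,\sigma^2\tau^2\lambda_i^2)$. The horseshoe estimator $T_\tau(y)=(T_\tau(y_1),\dots,T_\tau(y_n))$ is the posterior mean for fixed $\tau$, $T_\tau(y_i)=\mathbb{E}[\theta_i\mid y_i,\tau]$, when $Y\mid\theta\sim\mathcal{N}(\theta,\sigma^2I_n)$. $T_{\widehat\tau}(y)$ is obtained by plugging the (data-dependent) value $\widehat\tau=\widehat\tau(y)$ into $T_\tau(y)$ in place of $\tau$. *)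

(* Defs.v *)
From HB Require Import structures.
From mathcomp Require Import all_boot all_order all_algebra.
From mathcomp Require Import all_classical all_reals all_analysis.

Set Implicit Arguments.
Unset Strict Implicit.
Unset Printing Implicit Defensive.

Import Order.TTheory GRing.Theory Num.Theory.
Import numFieldNormedType.Exports.

Local Open Scope classical_set_scope.
Local Open Scope ring_scope.

(* Vectors of R^n are tuples: these carry the sigma-algebra generated by the
   coordinates. The library norm on row vectors is the sup norm, hence the
   explicit Euclidean norm below. *)
Section vectors.
Context {R : realType}.

Definition l2norm (n : nat) (x : n.-tuple R) : R :=
  Num.sqrt (\sum_(i < n) tnth x i ^+ 2).

Definition vsub (n : nat) (x y : n.-tuple R) : n.-tuple R :=
  [tuple tnth x i - tnth y i | i < n].

Definition ell0 (n k : nat) : set (n.-tuple R) :=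
  [set x : n.-tuple R | (#|[pred i | tnth x i != 0%R]| <= k)%N].

End vectors.

Section gaussian_vector.
Context {R : realType}.

Definition vcons (n : nat) (z : measurableTypeR R * n.-tuple R) : n.+1.-tuple R :=
  [the n.+1.-tuple R of (z.1 : R) :: z.2].

Lemma measurable_vcons n : measurable_fun setT (@vcons n).
Proof.
have mfst : measurable_fun setT
    (fun z : measurableTypeR R * n.-tuple R => z.1 : R).
  exact: (@measurable_fst _ _ (measurableTypeR R) (n.-tuple R)).
exact: (measurable_cons mfst measurable_snd).
Qed.

HB.instance Definition _ n :=
  isMeasurableFun.Build _ _ _ _ (@vcons n) (@measurable_vcons n).

(* The law N(theta, sigma^2 I_n), the n-fold product of the one-dimensional
   normal laws; it is characterized by normal_vec_box. *)
Fixpoint normal_vec (sigma : R) (n : nat) :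
    n.-tuple R -> probability (n.-tuple R) R :=
  match n return n.-tuple R -> probability (n.-tuple R) R with
  | 0 => fun=> \d_([tuple] : 0.-tuple R)
  | m.+1 => fun theta =>
      distribution
        (normal_prob (thead theta) sigma \x
           normal_vec sigma ([tuple of behead theta] : m.-tuple R))%E
        (@vcons m)
  end.

Let measurable_box (n : nat) (A : 'I_n -> set R) :
  (forall i, measurable (A i)) ->
  measurable [set y : n.-tuple R | forall i, A i (tnth y i)].
Proof.
move=> mA.
have -> : [set y : n.-tuple R | forall i, A i (tnth y i)] =
    \bigcap_(i in [set: 'I_n]) (fun y : n.-tuple R => tnth y i) @^-1` A i.
  by apply/seteqP; split=> y /= yA i => [_|]; exact: yA.
apply: fin_bigcap_measurable => // i _.
by rewrite -[X in measurable X]setTI; exact: measurable_tnth.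
Qed.

Lemma normal_vec_box (sigma : R) (n : nat) (theta : n.-tuple R)
    (A : 'I_n -> set R) : (forall i, measurable (A i)) ->
  normal_vec sigma theta [set y | forall i, A i (tnth y i)] =
  (\prod_(i < n) normal_prob (tnth theta i) sigma (A i))%E.
Proof.
elim: n theta A => [|n IHn] theta A mA.
  by rewrite big_ord0 /= diracE mem_set// => -[].
rewrite big_ord_recl /= /distribution /pushforward.
have -> : @vcons n @^-1` [set y | forall i, A i (tnth y i)] =
    A ord0 `*` [set y | forall i, A (lift ord0 i) (tnth y i)].
  apply/seteqP; split=> [[a t] /= zA|[a t] /= [Aa At] i].
    split=> [|i]; first by have := zA ord0; rewrite tnth0.
    by have := zA (lift ord0 i); rewrite tnthS.
  by have [j ->|->] := unliftP ord0 i; rewrite ?tnthS ?tnth0//; exact: At.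
have mB := @measurable_box n (fun i => A (lift ord0 i)) (fun i => mA _).
transitivity (normal_prob (thead theta) sigma (A ord0) *
    normal_vec sigma ([tuple of behead theta] : n.-tuple R)
      [set y | forall i, A (lift ord0 i) (tnth y i)])%E.
  by apply: product_measure1E => //; exact: (mA ord0).
congr (_ * _)%E.
apply: (etrans (IHn [tuple of behead theta] _ (fun i => mA (lift ord0 i)))).
apply: eq_bigr => i _; rewrite tnth_behead.
suff -> : inord i.+1 = lift ord0 i by [].
by apply: val_inj; rewrite /= inordK// ltnS ltn_ord.
Qed.

End gaussian_vector.

Section horseshoe.
Context {R : realType}.
Implicit Types (sigma tau y : R).
Local Notation mu := (@lebesgue_measure R).

Definition half_cauchy_pdf (l : R) : R :=
  if 0 < l then 2 / (pi * (1 + l ^+ 2)) else 0.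

(* The conditional expectation E[theta | y, tau] is a.e. defined only; Bayes'
   formula gives the version defined at every y and every tau > 0, which is the
   one where a data-dependent tau is plugged in. Below, z = (lambda, theta) and
   the posterior is a density with respect to Lebesgue measure on R^2. *)
Definition horseshoe_prior_pdf sigma tau (z : R * R) : R :=
  half_cauchy_pdf z.1 * normal_pdf 0 (sigma * tau * z.1) z.2.

Definition horseshoe_joint_pdf sigma tau y (z : R * R) : R :=
  horseshoe_prior_pdf sigma tau z * normal_pdf z.2 sigma y.

Definition horseshoe_posterior_pdf sigma tau y (z : R * R) : R :=
  horseshoe_joint_pdf sigma tau y z /
  \int[(mu \x mu)%E]_(w in setT) horseshoe_joint_pdf sigma tau y w.

Definition horseshoe_mean sigma tau y : R :=
  \int[(mu \x mu)%E]_(z in setT) (z.2 * horseshoe_posterior_pdf sigma tau y z).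

Definition horseshoe_estimator sigma tau (n : nat) (y : n.-tuple R) :
    n.-tuple R :=
  [tuple horseshoe_mean sigma tau (tnth y i) | i < n].

End horseshoe.

Section asymptotics.
Context {R : realType}.
Local Open Scope ereal_scope.

Definition lesssim (A : nat -> \bar R) (B : nat -> R) : Prop :=
  exists2 C : R, (0 < C)%R & \forall n \near \oo, A n <= (C * B n)%:E.

(* The constant and the threshold on n are uniform over x in D n. *)
Definition lesssim_on (I : nat -> Type) (D : forall n, set (I n))
    (A : forall n, I n -> \bar R) (B : nat -> R) : Prop :=
  exists2 C : R, (0 < C)%R &
    \forall n \near \oo, forall x, D n x -> A n x <= (C * B n)%:E.

Definition asymp (A : nat -> \bar R) (B : nat -> R) : Prop :=
  let r n := A n * ((B n)^-1)%:E in
  [/\ 0 < limn_einf r, limn_einf r <= limn_esup r & limn_esup r < +oo].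

End asymptotics.

Section plug_in.
Context {R : realType} (sigma : R) (p : nat -> nat).
Implicit Types (tau : nat -> R) (tauhat : forall n, n.-tuple R -> R).

Definition tau_ratio (n : nat) : R := (p n)%:R / n%:R.

Definition tau_ratio_log (n : nat) : R :=
  (p n)%:R / n%:R * Num.sqrt (ln (n%:R / (p n)%:R)).

(* The constraint tau <= 1/c is asked for large n only: p 1 = 1, so that asking
   it at n = 1 for tau = tau_ratio would force c = 1. *)
Definition overestimation_bound tauhat tau : Prop :=
  exists c : R, [/\ 1 <= c, \forall n \near \oo, tau n <= c^-1 &
    lesssim_on (fun n => ell0 (p n))
      (fun n (theta : n.-tuple R) =>
         normal_vec sigma theta [set y | tauhat n y > c * tau n])
      (fun n => (p n)%:R / n%:R)].

Definition underestimation_bound tauhat tau : Prop :=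
  exists g : nat -> nat -> R, [/\ forall m k, 0 < g m k < 1,
    forall n (theta : n.-tuple R), (0 < n)%N -> ell0 (p n) theta ->
      normal_vec sigma theta [set y | g n (p n) <= tauhat n y] = 1%E &
    lesssim_on (fun n => ell0 (p n))
      (fun n (theta : n.-tuple R) => (- ln (g n (p n)))%:E *
         normal_vec sigma theta [set y | (tauhat n y <= tau n)%R])%E
      (fun n => ln (n%:R / (p n)%:R))].

Definition sup_risk tauhat (n : nat) : \bar R :=
  ereal_sup [set 'E_(normal_vec sigma theta)[fun y : n.-tuple R =>
      (l2norm (vsub (horseshoe_estimator sigma (tauhat n y) y) theta) ^+ 2)%R]%E
    | theta in @ell0 R n (p n)].

End plug_in.

(* Main.v *)
Require Import Defs.
From HB Require Import structures.
From mathcomp Require Import all_boot all_order all_algebra.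
From mathcomp Require Import all_classical all_reals all_analysis.
From mathcomp Require Import measurable_realfun.
From mathcomp Require Import ring lra.

Set Implicit Arguments.
Unset Strict Implicit.
Unset Printing Implicit Defensive.

Import Order.TTheory GRing.Theory Num.Theory.
Import numFieldNormedType.Exports.

Local Open Scope classical_set_scope.
Local Open Scope ring_scope.

(** Given lambda, the model is Gaussian: the posterior mean of theta is
    (1 - kappa) y with kappa = 1 / (1 + tau^2 lambda^2), and y has law
    N(0, sigma^2 (1 + tau^2 lambda^2)). Integrating theta out by Tonelli and
    Fubini turns the posterior mean T_tau(y) into y N / D, where D is the
    integral over lambda of the joint density k of (lambda, y), and N is the
    integral of (1 - kappa) k ([horseshoe_meanE]). Two pointwise bounds follow,
    both monotone in tau, which is what makes them usable for a random tau:
    - T_tau(y) is small near 0: |T_tau(y)| <= 4 pi sigma tau e^(y^2 / (2 sigma^2))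
      ([horseshoe_mean_shrunk]);
    - T_tau(y) is never far from y: (T_tau(y) - y)^2 is at most a constant times
      1 + log (1 / tau), uniformly in y ([horseshoe_mean_bias]).

    Upper bounds. Let L = log (n / p_n); both choices of tau lie between p_n / n
    and (p_n / n) sqrt L. At a nonzero mean the loss is at most the bias bound at
    the random tau plus the noise. Its expectation is of order
    1 + E log (1 / tauhat), and the underestimation bound controls the
    contribution of tauhat <= tau by a multiple of L; for the truncated
    estimator, whose scale is at least 1 / n, the bound log n plays that part.
    At a zero mean let u = c tau and z^2 = 2 sigma^2 log (1 / u). When
    tauhat <= u, the loss is at most C u^2 e^(y^2 / sigma^2) for |y| <= z and y^2
    beyond, which under N(0, sigma^2) integrates to O(u z) ([null_risk]); when
    tauhat > u, the same holds up to an additional z^2, and the overestimation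
    bound makes this event contribute at most a multiple of z^2 p_n / n. Summing
    the n coordinates gives O(p_n L) ([plug_in_upper]).

    Lower bound. Put p_n means at m = (sigma / 2) sqrt L. With a probability
    bounded below, |Y_i - m| <= sigma, and then e^(Y_i^2 / (2 sigma^2)) is at
    most e (n / p_n)^(1/4), so that on tauhat <= c tau the estimate is at most
    m / 2 for n large. By the overestimation bound, restricting to tauhat <= c tau
    costs almost no probability, so that each of the p_n coordinates contributes
    at least a multiple of L ([risk_lower]). *)

(** * The half-Cauchy density *)

Section half_cauchy.
Context {R : realType}.
Implicit Types (sigma tau y l t : R).
Local Notation mu := (@lebesgue_measure R).

(** Written with a real power because x^-1 = x (x^2)^(-1) also holds at 0, where
    inversion is not continuous. *)
Lemma measurable_funV d (T : measurableType d) (f : T -> R) :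
  measurable_fun setT f -> measurable_fun setT (fun x => (f x)^-1).
Proof.
move=> mf.
rewrite (_ : (fun x => _) = fun x => f x * powR (f x ^+ 2) (-1)); last first.
  apply/funext => x; rewrite powR_inv1 ?sqr_ge0//.
  have [->|f0] := eqVneq (f x) 0; first by rewrite invr0 mul0r.
  by field.
apply: measurable_funM => //.
apply: (measurableT_comp (f := fun z : R => powR z (-1))); first exact: measurable_powR.
exact: measurable_funX.
Qed.

Lemma half_cauchy_pdf_ge0 l : 0 <= half_cauchy_pdf l.
Proof.
rewrite /half_cauchy_pdf; case: ifP => // _.
by rewrite divr_ge0// mulr_ge0 ?pi_ge0// addr_ge0// sqr_ge0.
Qed.

Lemma measurable_half_cauchy_pdf : measurable_fun setT (@half_cauchy_pdf R).
Proof.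
apply: measurable_fun_ifT => //=; first exact: measurable_fun_ltr.
apply: measurable_funM => //; apply: measurable_funV.
by apply: measurable_funM => //; apply: measurable_funD => //; exact: measurable_funX.
Qed.

(** Stated for every dilation of the density: the version with tau absorbs the
    factor tau^2 lambda^2 / (1 + tau^2 lambda^2) in the bound of N. *)
Lemma integral_half_cauchy tau : 0 < tau ->
  (\int[mu]_l (tau * half_cauchy_pdf (tau * l))%:E = 1)%E.
Proof.
move=> tau0.
pose f (l : R) := tau * (2 / pi) * (1 + (tau * l) ^+ 2)^-1.
transitivity (\int[mu]_(l in `]0%R, +oo[) (f l)%:E)%E.
  rewrite [RHS]integral_mkcond/=.
  apply: eq_integral => /= l _; rewrite /patch /= mem_setE in_itv/= andbT.
  rewrite /half_cauchy_pdf pmulr_rgt0//; case: ifP => // _; last by rewrite mulr0.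
  by rewrite /f invfM !mulrA.
have pos l : 0 < 1 + (tau * l) ^+ 2 by rewrite ltr_pwDl// sqr_ge0.
have cf : continuous f.
  move=> x; rewrite /f.
  apply: cvgM; first exact: cvg_cst.
  apply: cvgV; first by rewrite gt_eqF.
  apply: cvgD; first exact: cvg_cst.
  apply: (@continuous_comp _ _ _ ( *%R tau) (fun z : R => z ^+ 2)).
    by have := @mulrl_continuous R tau; apply.
  exact: exprn_continuous.
have dF l : is_derive l 1 (fun l => 2 / pi * atan (tau * l)) (f l).
  have dm : is_derive l 1 ( *%R tau) tau.
    by apply: is_derive_eq; rewrite ?scaler0 ?addr0; rewrite /GRing.scale/= mulr1.
  have da := is_derive1_comp (is_derive1_atan (tau * l)) dm.
  have := is_deriveZ (2 / pi) da.
  rewrite /f => h; apply: is_derive_eq h _.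
  by rewrite /GRing.scale/=; ring.
rewrite integral_itv_obnd_cbnd; last first.
  by apply/measurable_EFinP; apply: measurable_funTS; exact: continuous_measurable_fun.
rewrite (@ge0_continuous_FTC2y _ _ (fun l => 2 / pi * atan (tau * l)) _ 1).
- by rewrite mulr0 atan0 mulr0 sube0.
- by move=> x _; rewrite /f !mulr_ge0 ?invr_ge0 ?pi_ge0// ?(ltW tau0)// ltW.
- exact: continuous_subspaceT.
- rewrite [X in _ --> X](_ : 1 = 2 / pi * (pi / 2)); last first.
    by rewrite mulrA divfK ?divff// gt_eqF// pi_gt0.
  apply: cvgM; first exact: cvg_cst.
  apply: (@cvg_comp _ _ _ ( *%R tau) atan _ (@pinfty_nbhs R)); last exact: cvgy_atan.
  exact/gt0_cvgMry.
- by move=> x _; have [] := dF x.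
- apply: cvg_at_right_filter.
  suff : {for 0, continuous (fun l => 2 / pi * atan (tau * l))} by [].
  by apply: differentiable_continuous; apply/derivable1_diffP; have [] := dF 0.
- by move=> x _; rewrite derive1E; have [_ ->] := dF x.
Qed.

End half_cauchy.

(** * The normal density and its mean *)

Section normal_density.
Context {R : realType}.
Implicit Types (sigma tau y l t : R).
Local Notation mu := (@lebesgue_measure R).

Let measurable_reflect (m : R) : measurable_fun setT (fun t : R => 2 * m - t).
Proof. exact: measurable_funB. Qed.

Lemma lebesgue_measure_reflect (m : R) (A : set R) : measurable A ->
  pushforward mu ((fun t => 2 * m - t) : _ -> measurableTypeR R) A = mu A.
Proof.
move=> mA; apply/esym/lebesgue_measure_unique => //=.
  exact: measurable_reflect.
move=> _ ? [[a b]] _ <-; rewrite /pushforward/=.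
rewrite (_ : _ @^-1` _ = `[2 * m - b, 2 * m - a[%classic); last first.
  by apply/seteqP; split=> t /=; rewrite !in_itv/= => /andP[? ?]; apply/andP; split;
    lra.
rewrite !lebesgue_measure_itv/= !lte_fin.
by rewrite (_ : (2 * m - b < 2 * m - a) = (a < b)) ?ltrD2l ?ltrN2//;
  case: ifP => // _; rewrite -!EFinB; congr EFin; ring.
Qed.

Lemma integral_reflect (m : R) (f : R -> \bar R) : measurable_fun setT f ->
  mu.-integrable setT (f \o (fun t => 2 * m - t)) ->
  (\int[mu]_t f t = \int[mu]_t f (2 * m - t)%R)%E.
Proof.
move=> mf intf.
transitivity (integral (pushforward mu ((fun t => 2 * m - t) : _
  -> measurableTypeR R)) setT f).
  apply: eq_measure_integral; first exact: measurable_reflect.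
  by move=> ? A mA _; exact/esym/lebesgue_measure_reflect.
by rewrite integral_pushforward//; exact: measurable_reflect.
Qed.

Lemma normal_pdf_expE m s t : s != 0
  -> normal_pdf m s t = normal_peak s * expR (- (t - m) ^+ 2 / (s ^+ 2 *+ 2)).
Proof. by move=> s0; rewrite normal_pdfE. Qed.

(** Domination by a wider normal density bounds the second moment by a multiple of
    s^2 with no integration by parts. *)
Lemma normal_pdf_wider m s t : 0 < s ->
  (t - m) ^+ 2 * normal_pdf m s t <= 8 * s ^+ 2 * normal_pdf m (2 * s) t.
Proof.
move=> s0; rewrite !normal_pdf_expE ?gt_eqF ?mulr_gt0//.
have -> : normal_peak s = 2 * normal_peak (2 * s).
  rewrite /normal_peak (_ : (2 * s) ^+ 2 * pi *+ 2 = 2 ^+ 2 * (s ^+ 2 * pi *+ 2)).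
    by rewrite sqrtrM ?sqr_ge0// sqrtr_sqr ger0_norm// invfM mulrA divff// mul1r.
  by rewrite exprMn -mulrA mulrnAr.
set z := (t - m) ^+ 2.
have z0 : 0 <= z := sqr_ge0 _.
have -> : (2 * s) ^+ 2 *+ 2 = 8 * s ^+ 2 by ring.
have -> : - z / (s ^+ 2 *+ 2) = (- z / (8 * s ^+ 2)) + (- (3 * (z / (8 * s ^+ 2)))).
  by field; rewrite gt_eqF.
rewrite expRD; set E := expR _; set P := normal_peak _.
set v := z / (8 * s ^+ 2).
have -> : z = v * (8 * s ^+ 2) by rewrite /v divfK// mulf_neq0 ?expf_neq0 ?gt_eqF.
have v0 : 0 <= v by rewrite divr_ge0// mulr_ge0 ?sqr_ge0.
have hv : 2 * v * expR (- (3 * v)) <= 1.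
  rewrite expRN ler_pdivrMr ?expR_gt0// mul1r.
  by apply: le_trans (expR_ge1Dx _); lra.
have -> : v * (8 * s ^+ 2) * (2 * P * (E * expR (- (3 * v)))) =
  8 * s ^+ 2 * (P * E) * (2 * v * expR (- (3 * v))) by ring.
rewrite -[leRHS]mulr1 ler_wpM2l//.
by rewrite !mulr_ge0 ?(ltW s0) ?normal_peak_ge0 ?expR_ge0.
Qed.

Lemma normal_pdf_first_moment_bound m s t : 0 < s ->
  `|t| * normal_pdf m s t <=
  8 * s ^+ 2 * normal_pdf m (2 * s) t + (1 + `|m|) * normal_pdf m s t.
Proof.
move=> s0; have h := normal_pdf_wider m t s0.
have h1 : `|t| * normal_pdf m s t <= ((t - m) ^+ 2 + (1 + `|m|)) * normal_pdf m s t.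
  apply: ler_wpM2r; first exact: normal_pdf_ge0.
  have := ler_normD (t - m) m; rewrite subrK => /le_trans; apply.
  have -> : (t - m) ^+ 2 = `|t - m| ^+ 2 by rewrite -normrX ger0_norm ?sqr_ge0.
  by set w := `|t - m|; have : 0 <= w := normr_ge0 _; have := sqr_ge0 (w - 1); nra.
by apply: le_trans h1 _; rewrite mulrDl lerD2r.
Qed.

Lemma integrable_normal_pdfX m s : 0 < s ->
  mu.-integrable setT (fun t => (t * normal_pdf m s t)%:E).
Proof.
move=> s0.
have i1 : mu.-integrable setT (fun t
  => ((8 * s ^+ 2)%:E * (normal_pdf m (2 * s) t)%:E)%E).
  by apply: integrableZl => //; exact: integrable_normal_pdf.
have i2 : mu.-integrable setT (fun t => ((1 + `|m|)%:E * (normal_pdf m s t)%:E)%E).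
  by apply: integrableZl => //; exact: integrable_normal_pdf.
have i3 : mu.-integrable setT (fun t =>
    (8 * s ^+ 2 * normal_pdf m (2 * s) t + (1 + `|m|) * normal_pdf m s t)%:E).
  exact: (integrableD measurableT i1 i2).
apply: le_integrable i3 => //.
  by apply/measurable_EFinP; apply: measurable_funM => //; exact: measurable_normal_pdf.
move=> t _; rewrite lee_fin normrM (ger0_norm (normal_pdf_ge0 _ _ _)).
by apply: le_trans (ler_norm _); exact: normal_pdf_first_moment_bound.
Qed.

(** The reflection t -> 2 m - t preserves Lebesgue measure and changes the sign of
    (t - m) times the density. *)
Lemma normal_pdf_mean m s : 0 < s ->
  (\int[mu]_t (t * normal_pdf m s t)%:E = m%:E)%E.
Proof.
move=> s0.
have ig := integrable_normal_pdf m s.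
have iX := integrable_normal_pdfX m s0.
have iB : mu.-integrable setT (fun t => ((t - m) * normal_pdf m s t)%:E).
  rewrite (_ : (fun t => _) = (fun t
    => (t * normal_pdf m s t - m * normal_pdf m s t)%:E)).
    exact: (integrableB measurableT iX (integrableZl measurableT m ig)).
  by apply/funext => t; rewrite mulrBl.
have reflE t : (2 * m - t - m) * normal_pdf m s (2 * m - t)
  = - ((t - m) * normal_pdf m s t).
  rewrite -mulNr !normal_pdf_expE ?gt_eqF//.
  by congr (_ * (_ * expR (- _ / _))); ring.
have key : (\int[mu]_t ((t - m) * normal_pdf m s t)%:E = 0)%E.
  set I := integral _ _ _.
  have finI : I \is a fin_num by exact: integrable_fin_num.
  suff : (I = - I)%E.
    by rewrite -(fineK finI) -EFinN => -[] h; congr EFin; lra.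
  rewrite {1}/I (@integral_reflect m _ (measurable_int _ iB)); last first.
    rewrite (_ : _ \o _ = (fun t => (- ((t - m) * normal_pdf m s t))%:E)).
      exact: (integrableN iB).
    by apply/funext => t; rewrite /= reflE.
  rewrite -integralN//; last exact: integrable_add_def.
  by apply: eq_integral => t _; rewrite reflE.
under eq_integral do rewrite -[X in X * _](subrK m) mulrDl EFinD.
rewrite integralD//=; last exact: (integrableZl measurableT m ig).
rewrite key add0e.
under eq_integral do rewrite EFinM.
by rewrite integralZl// integral_normal_pdf mule1.
Qed.
End normal_density.

(** * The posterior mean as a ratio of integrals over the local scale *)

Section posterior_mean.
Context {R : realType}.
Implicit Types (sigma tau y l t : R).
Local Notation mu := (@lebesgue_measure R).

(** Bayes' formula for a N(0, a^2) prior and N(t, s^2) noise: the marginal of y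
    times the posterior of t. *)
Lemma normal_pdf_complete_square (a s t y : R) : 0 < a -> 0 < s ->
  normal_pdf 0 a t * normal_pdf t s y =
  normal_pdf 0 (Num.sqrt (a ^+ 2 + s ^+ 2)) y *
  normal_pdf (a ^+ 2 / (a ^+ 2 + s ^+ 2) * y) (a * s / Num.sqrt (a ^+ 2 + s ^+ 2)) t.
Proof.
move=> a0 s0.
have v0 : 0 < a ^+ 2 + s ^+ 2 by rewrite addr_gt0 ?exprn_gt0.
have r0 : 0 < Num.sqrt (a ^+ 2 + s ^+ 2) by rewrite sqrtr_gt0.
rewrite !normal_pdf_expE ?gt_eqF ?divr_gt0 ?mulr_gt0//.
rewrite [LHS]mulrACA [RHS]mulrACA -!expRD; congr (_ * expR _).
  rewrite /normal_peak; have := pi_ge0 R; move: (pi : R) => p p0.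
  rewrite -!invfM -!sqrtrM ?mulrn_wge0 ?mulr_ge0 ?(ltW a0) ?(ltW s0)//.
  congr (Num.sqrt _)^-1; rewrite expr_div_n !sqr_sqrtr ?(ltW v0)//.
  by field; rewrite gt_eqF.
rewrite expr_div_n !sqr_sqrtr ?(ltW v0)//.
by field; rewrite !gt_eqF.
Qed.

Variables (sigma tau : R) (sigma0 : 0 < sigma) (tau0 : 0 < tau).

(** The coefficient kappa: given lambda = l, the posterior mean is (1 - kappa) y. *)
Definition shrinkage (tau l : R) : R := (1 + (tau * l) ^+ 2)^-1.

(** The joint density of (lambda, y), theta being integrated out. *)
Definition scale_obs_pdf (sigma tau y l : R) : R :=
  half_cauchy_pdf l * normal_pdf 0 (sigma * Num.sqrt (1 + (tau * l) ^+ 2)) y.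

Let one_sqr_gt0 (u : R) : 0 < 1 + u ^+ 2. Proof. by rewrite ltr_pwDl// sqr_ge0. Qed.

Lemma shrinkage_gt0 l : 0 < shrinkage tau l.
Proof. by rewrite invr_gt0. Qed.

Lemma shrinkage_le1 l : shrinkage tau l <= 1.
Proof. by rewrite invf_le1// lerDl sqr_ge0. Qed.

(** The second factor is the conditional density of theta given lambda and y, so
    that integrating theta out leaves the first one. *)
Lemma horseshoe_joint_pdfE y (z : R * R) : horseshoe_joint_pdf sigma tau y z =
  scale_obs_pdf sigma tau y z.1 *
  normal_pdf ((1 - shrinkage tau z.1) * y) (sigma * tau * z.1 * Num.sqrt (shrinkage
    tau z.1)) z.2.
Proof.
case: z => l t; rewrite /horseshoe_joint_pdf /horseshoe_prior_pdf /scale_obs_pdf/=.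
rewrite {1 2}/half_cauchy_pdf; case: ifPn => l0; last by rewrite !mul0r.
have a0 : 0 < sigma * tau * l by rewrite !mulr_gt0.
rewrite -[LHS]mulrA normal_pdf_complete_square// [LHS]mulrA -(mulrA sigma tau l).
rewrite /shrinkage; set u := tau * l; have v0 := one_sqr_gt0 u.
rewrite (_ : (sigma * u) ^+ 2 + sigma ^+ 2 = sigma ^+ 2 * (1 + u ^+ 2)); last by ring.
have -> : (sigma * u) ^+ 2 / (sigma ^+ 2 * (1 + u ^+ 2)) = 1 - (1 + u ^+ 2)^-1.
  by field; rewrite !gt_eqF.
have -> : Num.sqrt (sigma ^+ 2 * (1 + u ^+ 2)) = sigma * Num.sqrt (1 + u ^+ 2).
  by rewrite sqrtrM ?sqr_ge0// sqrtr_sqr ger0_norm ?(ltW sigma0).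
have -> : sigma * u * sigma / (sigma * Num.sqrt (1 + u ^+ 2))
  = sigma * u * Num.sqrt (1 + u ^+ 2)^-1.
  rewrite sqrtrV ?(ltW v0)//; have := v0; rewrite -sqrtr_gt0 => r0.
  by field; rewrite !gt_eqF.
by [].
Qed.


Lemma measurable_sqrt d (T : measurableType d) (f : T -> R) :
  measurable_fun setT f -> measurable_fun setT (fun x => Num.sqrt (f x)).
Proof.
move=> mf; apply: (measurableT_comp (f := Num.sqrt : R -> R)) => //.
by apply: continuous_measurable_fun; exact: sqrt_continuous.
Qed.

Lemma measurable_normal_pdf_comp d (T : measurableType d) (m s x : T -> R) :
  measurable_fun setT m -> measurable_fun setT s -> measurable_fun setT x ->
  measurable_fun setT (fun z => normal_pdf (m z) (s z) (x z)).
Proof.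
move=> mm ms mx; rewrite /normal_pdf; apply: measurable_fun_ifT.
- exact: measurable_fun_eqr.
- apply: (measurableT_comp (f := (\1_(`[0, 1]%classic) : R -> R)) _ mx);
  exact: measurable_indic.
rewrite /normal_peak /normal_fun.
apply: measurable_funM.
  apply: measurable_funV; apply: measurable_sqrt.
  under eq_fun do rewrite -mulr_natr.
  by apply: measurable_funM => //; apply: measurable_funM => //; exact: measurable_funX.
apply: (measurableT_comp (f := expR)); first exact: measurable_expR.
apply: measurable_funM.
  by apply: measurable_funN; apply: measurable_funX; exact: measurable_funB.
apply: measurable_funV; under eq_fun do rewrite -mulr_natr.
by apply: measurable_funM => //; exact: measurable_funX.
Qed.

Lemma measurable_prior_pdf : measurable_fun setT (@horseshoe_prior_pdf R sigma tau).
Proof.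
apply: measurable_funM.
  by apply: (measurableT_comp (f := @half_cauchy_pdf R));
    [exact: measurable_half_cauchy_pdf|exact: measurable_fst].
by apply: measurable_normal_pdf_comp => //; apply: measurable_funM.
Qed.

Lemma measurable_joint_pdf y : measurable_fun setT (@horseshoe_joint_pdf R sigma tau y).
Proof.
apply: measurable_funM; first exact: measurable_prior_pdf.
exact: measurable_normal_pdf_comp.
Qed.

Lemma measurable_shrinkage : measurable_fun setT (@shrinkage tau).
Proof.
apply: measurable_funV; apply: measurable_funD => //; apply: measurable_funX.
exact: measurable_funM.
Qed.

Lemma measurable_scale_obs_pdf y : measurable_fun setT (@scale_obs_pdf sigma tau y).
Proof.
apply: measurable_funM; first exact: measurable_half_cauchy_pdf.
apply: measurable_normal_pdf_comp => //; apply: measurable_funM => //.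
apply: measurable_sqrt; apply: measurable_funD => //; apply: measurable_funX;
  exact: measurable_funM.
Qed.

Lemma horseshoe_prior_pdf_ge0 z : 0 <= horseshoe_prior_pdf sigma tau z.
Proof. by rewrite mulr_ge0 ?half_cauchy_pdf_ge0 ?normal_pdf_ge0. Qed.

Lemma horseshoe_joint_pdf_ge0 y z : 0 <= horseshoe_joint_pdf sigma tau y z.
Proof. by rewrite mulr_ge0 ?horseshoe_prior_pdf_ge0 ?normal_pdf_ge0. Qed.

Lemma scale_obs_pdf_ge0 y l : 0 <= scale_obs_pdf sigma tau y l.
Proof. by rewrite mulr_ge0 ?half_cauchy_pdf_ge0 ?normal_pdf_ge0. Qed.

Lemma integral_half_cauchy1 : (\int[mu]_l (half_cauchy_pdf l)%:E = 1)%E.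
Proof. by rewrite -(integral_half_cauchy ltr01); apply: eq_integral => l _;
  rewrite !mul1r. Qed.

Lemma integral_prior_pdf :
  (\int[mu \x mu]_z (horseshoe_prior_pdf sigma tau z)%:E = 1)%E.
Proof.
rewrite fubini_tonelli1//; last 2 first.
- by apply/measurable_EFinP; exact: measurable_prior_pdf.
- by move=> z; rewrite lee_fin horseshoe_prior_pdf_ge0.
rewrite -integral_half_cauchy1; apply: eq_integral => l _; rewrite /fubini_F.
under eq_integral do rewrite /horseshoe_prior_pdf EFinM/=.
rewrite ge0_integralZl_EFin ?half_cauchy_pdf_ge0 ?integral_normal_pdf ?mule1//.
- by move=> t _; rewrite lee_fin normal_pdf_ge0.
- by apply/measurable_EFinP; exact: measurable_normal_pdf.
Qed.

Lemma integral_joint_pdf y :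
  (\int[mu \x mu]_z (horseshoe_joint_pdf sigma tau y z)%:E =
   \int[mu]_l (scale_obs_pdf sigma tau y l)%:E)%E.
Proof.
rewrite fubini_tonelli1//; last 2 first.
- by apply/measurable_EFinP; exact: measurable_joint_pdf.
- by move=> z; rewrite lee_fin horseshoe_joint_pdf_ge0.
apply: eq_integral => l _; rewrite /fubini_F.
under eq_integral do rewrite horseshoe_joint_pdfE EFinM/=.
rewrite ge0_integralZl_EFin ?scale_obs_pdf_ge0 ?integral_normal_pdf ?mule1//.
- by move=> t _; rewrite lee_fin normal_pdf_ge0.
- by apply/measurable_EFinP; exact: measurable_normal_pdf.
Qed.

Lemma integrable_prior_pdf : (mu \x mu)%E.-integrable setT
  (fun z => (horseshoe_prior_pdf sigma tau z)%:E).
Proof.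
apply/integrableP; split; first by apply/measurable_EFinP; exact: measurable_prior_pdf.
under eq_integral do rewrite gee0_abs ?lee_fin ?horseshoe_prior_pdf_ge0//.
by rewrite integral_prior_pdf ltry.
Qed.

Lemma integrable_joint_pdf y : (mu \x mu)%E.-integrable setT
  (fun z => (horseshoe_joint_pdf sigma tau y z)%:E).
Proof.
apply: (le_integrable _ _ _ (integrableZl _ (normal_peak sigma)
  integrable_prior_pdf)) => //.
  by apply/measurable_EFinP; exact: measurable_joint_pdf.
move=> z _; rewrite lee_fin !ger0_norm ?horseshoe_joint_pdf_ge0//; last first.
  by rewrite mulr_ge0 ?normal_peak_ge0 ?horseshoe_prior_pdf_ge0.
by rewrite [leRHS]mulrC ler_wpM2l ?horseshoe_prior_pdf_ge0// normal_pdf_ub// gt_eqF.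
Qed.

(** Fubini's theorem needs theta to be integrable under the joint density: the
    likelihood times |theta| is bounded for fixed y, and the prior has mass 1. *)
Lemma integrable_joint_pdfX y : (mu \x mu)%E.-integrable setT
  (fun z => (z.2 * horseshoe_joint_pdf sigma tau y z)%:E).
Proof.
pose C := 8 * sigma ^+ 2 * normal_peak (2 * sigma) + (1 + `|y|) * normal_peak sigma.
have C0 : 0 <= C by rewrite addr_ge0 ?mulr_ge0 ?(ltW sigma0)
  ?normal_peak_ge0// addr_ge0.
apply: (le_integrable _ _ _ (integrableZl _ C integrable_prior_pdf)) => //.
  by apply/measurable_EFinP; apply: measurable_funM => //; exact: measurable_joint_pdf.
move=> [l t] _; rewrite lee_fin [leLHS]normrM (ger0_norm (horseshoe_joint_pdf_ge0 _
  _)) [leRHS]ger0_norm; last first.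
  by rewrite mulr_ge0 ?horseshoe_prior_pdf_ge0.
rewrite /horseshoe_joint_pdf/= mulrCA mulrC ler_wpM2r ?horseshoe_prior_pdf_ge0//.
have -> : normal_pdf t sigma y = normal_pdf y sigma t.
  by rewrite !normal_pdf_expE ?gt_eqF// -(sqrrN (y - t)) opprB.
by apply: le_trans (normal_pdf_first_moment_bound _ _ sigma0) _;
  rewrite /C lerD// ler_wpM2l ?normal_pdf_ub ?gt_eqF ?mulr_gt0// ?addr_ge0 ?mulr_ge0
  ?(ltW sigma0).
Qed.

Lemma integrable_scale_obs_pdf y : mu.-integrable setT (fun l
  => (scale_obs_pdf sigma tau y l)%:E).
Proof.
apply/integrableP; split; first by apply/measurable_EFinP;
  exact: measurable_scale_obs_pdf.
under eq_integral do rewrite gee0_abs ?lee_fin ?scale_obs_pdf_ge0//.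
rewrite -integral_joint_pdf -ge0_fin_numE; last by apply: integral_ge0 => z _;
  rewrite lee_fin horseshoe_joint_pdf_ge0.
exact: integrable_fin_num (integrable_joint_pdf y).
Qed.

Lemma integral_joint_pdfX y :
  (\int[mu \x mu]_z (z.2 * horseshoe_joint_pdf sigma tau y z)%:E =
   \int[mu]_l (y * ((1 - shrinkage tau l) * scale_obs_pdf sigma tau y l))%:E)%E.
Proof.
rewrite -integral12_prod_meas1; last exact: integrable_joint_pdfX.
apply: eq_integral => l _; rewrite /fubini_F/=.
have [l0|l0] := leP l 0.
  have k0 : scale_obs_pdf sigma tau y l = 0.
    by rewrite /scale_obs_pdf /half_cauchy_pdf ltNge l0 mul0r.
  rewrite k0 !mulr0; apply: integral0_eq => t _.
  by rewrite horseshoe_joint_pdfE/= k0 mul0r mulr0.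
have s0 : 0 < sigma * tau * l * Num.sqrt (shrinkage tau l).
  by rewrite !mulr_gt0 ?sqrtr_gt0 ?shrinkage_gt0.
under eq_integral do rewrite horseshoe_joint_pdfE/= mulrCA EFinM.
rewrite integralZl//; last exact: integrable_normal_pdfX.
by rewrite normal_pdf_mean// -EFinM; congr EFin; ring.
Qed.

Theorem horseshoe_meanE y : horseshoe_mean sigma tau y =
  y * ((\int[mu]_l ((1 - shrinkage tau l) * scale_obs_pdf sigma tau y l)) /
       \int[mu]_l scale_obs_pdf sigma tau y l).
Proof.
rewrite /horseshoe_mean /horseshoe_posterior_pdf.
have -> : (\int[(mu \x mu)%E]_(w in setT) horseshoe_joint_pdf sigma tau y w)
  = \int[mu]_l scale_obs_pdf sigma tau y l.
  by rewrite /Rintegral integral_joint_pdf.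
set D := \int[mu]_l scale_obs_pdf sigma tau y l.
under eq_Rintegral do rewrite mulrA.
rewrite RintegralZr//; last exact: integrable_joint_pdfX.
rewrite mulrA; congr (_ / _).
rewrite -RintegralZl//; first by rewrite /Rintegral integral_joint_pdfX.
apply: (le_integrable _ _ _ (integrable_scale_obs_pdf y)) => //.
  apply/measurable_EFinP; apply: measurable_funM; last exact: measurable_scale_obs_pdf.
  by apply: measurable_funB => //; exact: measurable_shrinkage.
move=> l _; rewrite lee_fin normrM ler_piMl//.
by rewrite ger0_norm ?subr_ge0 ?shrinkage_le1// gerBl ltW ?shrinkage_gt0.
Qed.
End posterior_mean.

(** * Shrinkage and bias of the posterior mean *)

Section posterior_bounds.
Context {R : realType}.
Local Notation mu := (@lebesgue_measure R).

Lemma Rintegral_ge_itv (f : R -> R) (a b c : R) : a <= b -> 0 <= c ->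
  (forall l, 0 <= f l) -> mu.-integrable setT (EFin \o f) ->
  (forall l, a < l < b -> c <= f l) -> (b - a) * c <= \int[mu]_l f l.
Proof.
move=> ab c0 f0 intf cf.
rewrite -lee_fin /Rintegral fineK; last exact: integrable_fin_num.
have mf := measurable_int _ intf.
apply: (@le_trans _ _ (\int[mu]_(l in `]a, b[) (f l)%:E)%E); last first.
  by apply: ge0_subset_integral => // l _; rewrite lee_fin.
have -> : ((b - a) * c)%:E = (\int[mu]_(l in `]a, b[) cst c%:E l)%E.
  rewrite integral_cst//= lebesgue_measure_itv/= lte_fin mulrC.
  case: ltP => // ba; rewrite mule0; congr EFin.
  by rewrite (_ : b = a) ?subrr ?mulr0//; apply/eqP; rewrite eq_le ab ba.
apply: ge0_le_integral => //=.
by apply: measurable_funTS.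
Qed.

Variables (sigma : R) (sigma0 : 0 < sigma).
Local Notation c0 := (normal_peak sigma).

(** Normalized so that its square is y^2 / (2 sigma^2), the exponent of the
    Gaussian likelihood. *)
Definition scaled_abs (y : R) := `|y| / (sigma * Num.sqrt 2).

Lemma scaled_abs_ge0 y : 0 <= scaled_abs y.
Proof. by rewrite divr_ge0// mulr_ge0 ?sqrtr_ge0 ?ltW. Qed.

Lemma normr_scaled_abs y : `|y| = sigma * Num.sqrt 2 * scaled_abs y.
Proof. by rewrite /scaled_abs mulrC divfK// mulf_neq0 ?gt_eqF// sqrtr_gt0. Qed.

Lemma scaled_abs_sqr y : scaled_abs y ^+ 2 = y ^+ 2 / (2 * sigma ^+ 2).
Proof.
rewrite /scaled_abs expr_div_n exprMn sqr_sqrtr// (mulrC (sigma ^+ 2)).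
by rewrite -normrX ger0_norm ?sqr_ge0.
Qed.

Lemma scale_obs_pdfE tau y l : scale_obs_pdf sigma tau y l =
  half_cauchy_pdf l * (c0 * (Num.sqrt (shrinkage tau l) *
    expR (- (scaled_abs y ^+ 2 * shrinkage tau l)))).
Proof.
have v0 : 0 < 1 + (tau * l) ^+ 2 by rewrite ltr_pwDl// sqr_ge0.
have r0 : 0 < Num.sqrt (1 + (tau * l) ^+ 2) by rewrite sqrtr_gt0.
rewrite /scale_obs_pdf normal_pdf_expE ?gt_eqF ?mulr_gt0//; congr (_ * _).
rewrite mulrA; congr (_ * expR _).
  rewrite /normal_peak exprMn sqr_sqrtr ?(ltW v0)// /shrinkage.
  rewrite sqrtrV ?(ltW v0)// -invfM -sqrtrM; last first.
    by rewrite mulrn_wge0// mulr_ge0 ?pi_ge0 ?sqr_ge0.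
  by congr (Num.sqrt _)^-1; rewrite -mulrA (mulrC (1 + _)) mulrA mulrnAl.
rewrite scaled_abs_sqr exprMn sqr_sqrtr ?(ltW v0)// /shrinkage subr0.
by field; rewrite !gt_eqF.
Qed.

Section fixed_tau.
Variables (tau : R) (tau0 : 0 < tau) (tau1 : tau <= 1) (y : R).
Let k := scale_obs_pdf sigma tau y.
Let q l := shrinkage tau l.
(* locked, so that positivity rewriting does not unfold w to a quotient *)
Let w := locked (scaled_abs y).
(* the posterior mean is y N / D *)
Let D := \int[mu]_l k l.
Let N := \int[mu]_l ((1 - q l) * k l).

Let wE : w = scaled_abs y. Proof. by rewrite /w -lock. Qed.

Let q0 l : 0 <= q l. Proof. by rewrite ltW// shrinkage_gt0. Qed.
Let q1 l : q l <= 1. Proof. exact: shrinkage_le1. Qed.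
Let k0 l : 0 <= k l. Proof. exact: scale_obs_pdf_ge0. Qed.
Let ik : mu.-integrable setT (EFin \o k).
Proof. exact: integrable_scale_obs_pdf. Qed.

Let mq : measurable_fun setT q. Proof. exact: measurable_shrinkage. Qed.
Let mk : measurable_fun setT k. Proof. exact: measurable_scale_obs_pdf. Qed.

Let iN : mu.-integrable setT (fun l => ((1 - q l) * k l)%:E).
Proof.
apply: (le_integrable _ _ _ ik) => //.
  by apply/measurable_EFinP; apply: measurable_funM => //; exact: measurable_funB.
move=> l _; rewrite lee_fin normrM ler_piMl//.
by rewrite ger0_norm ?subr_ge0// gerBl.
Qed.

Let iq : mu.-integrable setT (fun l => (q l * k l)%:E).
Proof.
apply: (le_integrable _ _ _ ik) => //.
  by apply/measurable_EFinP; exact: measurable_funM.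
by move=> l _; rewrite lee_fin normrM ler_piMl// ger0_norm.
Qed.

Let DBN : D - N = \int[mu]_l (q l * k l).
Proof.
rewrite /D /N -RintegralB//; apply: eq_Rintegral => l _; ring.
Qed.

Let N0 : 0 <= N.
Proof. by apply: Rintegral_ge0 => l _; rewrite mulr_ge0// subr_ge0. Qed.

Let ND : N <= D.
Proof.
by rewrite -subr_ge0 DBN; apply: Rintegral_ge0 => l _; rewrite mulr_ge0.
Qed.

Let c00 : 0 < c0. Proof. by rewrite normal_peak_gt0// gt_eqF. Qed.

(* obtained by keeping lambda in (0, 1) only *)
Let D_ge_exp : c0 * expR (- w ^+ 2) / (2 * pi) <= D.
Proof.
have p0 := pi_gt0 R.
have := @Rintegral_ge_itv k 0 1 (c0 * expR (- w ^+ 2) / (2 * pi)) ler01.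
rewrite subr0 mul1r; apply => //.
  by rewrite divr_ge0 ?mulr_ge0 ?expR_ge0 ?(ltW c00) ?(ltW p0).
move=> l /andP[l0 l1]; rewrite /k scale_obs_pdfE.
have u1 : (tau * l) ^+ 2 <= 1.
  by rewrite expr_le1// ?mulr_ge0 ?(ltW tau0) ?(ltW l0)// mulr_ile1// ltW.
have q14 : 1 / 2 <= Num.sqrt (shrinkage tau l).
  rewrite -(ger0_norm (_ : 0 <= 1 / 2)) ?divr_ge0// -sqrtr_sqr ler_sqrt ?q0//.
  by rewrite /shrinkage expr_div_n expr1n div1r lef_pV2 ?posrE ?ltr_pwDl ?sqr_ge0//;
    lra.
have hc : 1 / pi <= half_cauchy_pdf l.
  rewrite /half_cauchy_pdf l0 ler_pdivrMr//.
  rewrite (_ : 2 / _ * pi = 2 / (1 + l ^+ 2));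
    last by rewrite invfM (mulrC pi^-1) mulrA divfK ?gt_eqF.
  have l21 : l ^+ 2 <= 1 by rewrite expr_le1 ?ltW.
  by rewrite ler_pdivlMr ?ltr_pwDl ?sqr_ge0//; lra.
have he : expR (- w ^+ 2) <= expR (- (scaled_abs y ^+ 2 * shrinkage tau l)).
  by rewrite ler_expR lerN2 -wE ler_piMr ?sqr_ge0.
rewrite (_ : _ / _ = 1 / pi * (c0 * (1 / 2 * expR (- w ^+ 2)))); last first.
  by rewrite invfM; ring.
have h2 : 0 <= 1 / 2 :> R by rewrite divr_ge0.
apply: ler_pM => //; first by rewrite divr_ge0// ltW.
  by rewrite mulr_ge0 ?(ltW c00)// mulr_ge0// expR_ge0.
by rewrite ler_pM2l// ler_pM// expR_ge0.
Qed.

Let kE l : k l = half_cauchy_pdf l * (c0 * (Num.sqrt (q l) * expR (- (w ^+ 2 * q l)))).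
Proof. by rewrite wE; exact: scale_obs_pdfE. Qed.

Let w0 : 0 <= w. Proof. by rewrite wE scaled_abs_ge0. Qed.

Let half_cauchy_scale l : (1 - q l) * half_cauchy_pdf l
  <= tau * (tau * half_cauchy_pdf (tau * l)).
Proof.
rewrite /half_cauchy_pdf pmulr_rgt0//; case: ifPn => l0; last by rewrite !mulr0.
have v0 u : 0 < 1 + u ^+ 2 :> R by rewrite ltr_pwDl// sqr_ge0.
rewrite !invfM; set P := pi^-1; have P0 : 0 <= P by rewrite invr_ge0 pi_ge0.
have -> : 1 - q l = (tau * l) ^+ 2 * (1 + (tau * l) ^+ 2)^-1.
  by rewrite /q /shrinkage; field; rewrite gt_eqF.
set V := (1 + (tau * l) ^+ 2)^-1; have V0 : 0 <= V by rewrite invr_ge0 ltW.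
have -> : (tau * l) ^+ 2 * V * (2 * (P * (1 + l ^+ 2)^-1)) =
  tau * (tau * (2 * (P * V))) * (l ^+ 2 / (1 + l ^+ 2)) by ring.
rewrite ler_piMr ?mulr_ge0 ?(ltW tau0)//.
by rewrite ler_pdivrMr// mul1r lerDr.
Qed.

(* w sqrt(kappa) e^(-w^2 kappa) <= 1 turns the exponential into the factor 1 / w *)
Let wN_le : w * N <= c0 * tau.
Proof.
have ihc : mu.-integrable setT (fun l => (tau * half_cauchy_pdf (tau * l))%:E).
  apply/integrableP; split.
    apply/measurable_EFinP; apply: measurable_funM => //.
    apply: (measurableT_comp (f := @half_cauchy_pdf R));
      first exact: measurable_half_cauchy_pdf.
    exact: measurable_funM.
  under eq_integral do rewrite gee0_abs ?lee_fin ?mulr_ge0 ?half_cauchy_pdf_ge0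
    ?(ltW tau0)//.
  by rewrite integral_half_cauchy// ltry.
have -> : c0 * tau = \int[mu]_l (c0 * tau * (tau * half_cauchy_pdf (tau * l))).
  rewrite RintegralZl// /Rintegral integral_half_cauchy//= mulr1//.
rewrite /N -RintegralZl//; apply: le_Rintegral => //.
- exact: (integrableZl _ w iN).
- exact: (integrableZl _ (c0 * tau) ihc).
move=> l _; rewrite kE.
set s := Num.sqrt (q l); have s0 : 0 <= s by rewrite sqrtr_ge0.
have qE : q l = s ^+ 2 by rewrite sqr_sqrtr.
have h1 : w * s * expR (- (w ^+ 2 * q l)) <= 1.
  rewrite expRN ler_pdivrMr ?expR_gt0// mul1r qE -exprMn.
  apply: le_trans (expR_ge1Dx _); have := sqr_ge0 (w * s - 1); have := mulr_ge0 w0 s0.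
  set z := w * s; nra.
have := half_cauchy_scale l; set B := tau * (_ * _); set H := half_cauchy_pdf l => h2.
have -> : w * ((1 - q l) * (H * (c0 * (s * expR (- (w ^+ 2 * q l)))))) =
  c0 * (((1 - q l) * H) * (w * s * expR (- (w ^+ 2 * q l)))) by ring.
rewrite -[leRHS]mulrA ler_wpM2l ?(ltW c00)//.
apply: le_trans h2; rewrite ler_piMr// mulr_ge0 ?half_cauchy_pdf_ge0// subr_ge0//.
Qed.
(* obtained by keeping tau * lambda in (w, 2 w) only: there kappa is of order
   1 / w^2, so that the exponential is bounded below *)
Let D_ge_tail : 1 <= w -> c0 * tau * expR (-1) * 2 / (15 * pi * w ^+ 2) <= D.
Proof.
move=> w1; have p0 := pi_gt0 R; have wp : 0 < w by lra.
pose c := 2 * tau ^+ 2 / (5 * pi * w ^+ 2) * (c0 * ((3 * w)^-1 * expR (-1))).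
have -> : c0 * tau * expR (-1) * 2 / (15 * pi * w ^+ 2) = (2 * w / tau - w / tau) * c.
  rewrite /c; move: (pi : R) p0 => p p0.
  by field; rewrite !gt_eqF.
have c1 : 0 <= c.
  rewrite /c mulr_ge0 ?divr_ge0 ?mulr_ge0 ?(ltW tau0) ?(ltW p0) ?(ltW c00) ?expR_ge0//.
by rewrite invr_ge0 mulr_ge0.
apply: Rintegral_ge_itv => //; first by rewrite ler_pM2r ?invr_gt0//; lra.
move=> l /andP[]; rewrite ltr_pdivrMr// ltr_pdivlMr// => h1 h2.
have l0 : 0 < l by rewrite -(pmulr_lgt0 _ tau0); lra.
set u := l * tau in h1 h2.
have u2 : w ^+ 2 <= u ^+ 2 <= 4 * w ^+ 2 by apply/andP; split; nra.
have qu : q l = (1 + u ^+ 2)^-1 by rewrite /q /shrinkage mulrC.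
have v0 : 0 < 1 + u ^+ 2 by rewrite ltr_pwDl// sqr_ge0.
rewrite kE /c; apply: ler_pM.
- by rewrite divr_ge0 ?mulr_ge0 ?(ltW tau0) ?(ltW p0).
- by rewrite mulr_ge0 ?(ltW c00)// mulr_ge0 ?expR_ge0// invr_ge0 mulr_ge0.
- have h5 : 0 < 5 * pi * w ^+ 2 by apply: mulr_gt0; [exact: mulr_gt0|exact: exprn_gt0].
  have hp : 0 < pi * (1 + l ^+ 2) by apply: mulr_gt0 => //; rewrite ltr_pwDl// sqr_ge0.
  rewrite /half_cauchy_pdf l0 ler_pdivrMr// mulrAC ler_pdivlMr//.
  have -> : 2 * tau ^+ 2 * (pi * (1 + l ^+ 2)) = 2 * pi * (tau ^+ 2 + u ^+ 2)
    by rewrite /u; ring.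
  have -> : 2 * (5 * pi * w ^+ 2) = 2 * pi * (5 * w ^+ 2) by ring.
  rewrite ler_wpM2l//; first by apply: mulr_ge0 => //; exact: ltW.
  have t1 : tau ^+ 2 <= w ^+ 2 by rewrite lerXn2r ?nnegrE ?(ltW tau0)// (le_trans tau1).
  by move: u2 => /andP[]; lra.
- rewrite ler_wpM2l ?(ltW c00)// ler_pM ?expR_ge0 ?invr_ge0 ?mulr_ge0//.
    rewrite -(ger0_norm (_ : 0 <= (3 * w)^-1)) ?invr_ge0
      ?mulr_ge0// -sqrtr_sqr ler_sqrt ?q0//.
    rewrite qu exprVn lef_pV2 ?posrE ?exprn_gt0 ?mulr_gt0//; nra.
  rewrite ler_expR lerN2 qu ler_pdivrMr// mul1r; lra.
Qed.

(* kappa k is at most d k where kappa <= d, and exponentially small elsewhere *)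
Let DN_split (d : R) : 0 <= d -> D - N <= d * D + c0 * expR (- (w ^+ 2 * d)).
Proof.
move=> d0.
have ihc : mu.-integrable setT (fun l : R => (half_cauchy_pdf l)%:E).
  apply/integrableP; split; first by apply/measurable_EFinP;
    exact: measurable_half_cauchy_pdf.
  under eq_integral do rewrite gee0_abs ?lee_fin ?half_cauchy_pdf_ge0//.
  by rewrite integral_half_cauchy1 ltry.
set E := expR _.
have -> : d * D + c0 * E = \int[mu]_l (d * k l + c0 * E * half_cauchy_pdf l).
  rewrite RintegralD//; last 2 first.
  - exact: (integrableZl _ d ik).
  - exact: (integrableZl _ (c0 * E) ihc).
  by rewrite !RintegralZl// [X in _
    = _ + _ * X]/Rintegral integral_half_cauchy1/= mulr1.
rewrite DBN; apply: le_Rintegral => //.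
  exact: (integrableD _ (integrableZl _ d ik) (integrableZl _ (c0 * E) ihc)).
move=> l _; have [qd|dq] := leP (q l) d.
  apply: (@le_trans _ _ (d * k l)); first by rewrite ler_wpM2r.
  by rewrite lerDl !mulr_ge0 ?expR_ge0 ?half_cauchy_pdf_ge0 ?(ltW c00).
apply: (@le_trans _ _ (c0 * E * half_cauchy_pdf l)); last by rewrite lerDr mulr_ge0.
rewrite kE.
set H := half_cauchy_pdf l; have H0 : 0 <= H := half_cauchy_pdf_ge0 _.
rewrite (_ : q l * _ = c0 * H * (q l * Num.sqrt (q l) * expR (- (w ^+ 2 * q l))));
  last by ring.
rewrite (_ : c0 * E * H = c0 * H * (1 * E)); last by ring.
rewrite ler_wpM2l ?mulr_ge0 ?(ltW c00)// ler_pM ?mulr_ge0 ?expR_ge0 ?sqrtr_ge0//.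
  by rewrite mulr_ile1 ?sqrtr_ge0// -sqrtr1 ler_sqrt.
by rewrite ler_expR lerN2 ler_wpM2l ?sqr_ge0// ltW.
Qed.

Let D_gt0 : 0 < D.
Proof.
apply: lt_le_trans D_ge_exp; rewrite divr_gt0 ?mulr_gt0 ?expR_gt0 ?pi_gt0//.
Qed.

(* DN_split with d = 2 r / w, where r^2 = 1 + log (1 / tau): when w >= r the
   exponential e^(-2 r w) is at most tau e^(-w), and D_ge_tail beats it; the
   constant collects 15 pi e / 2 from D_ge_tail and w^3 <= 6 e^w *)
Let wDN_le : w * (D - N) <= (2 * Num.sqrt (1 - ln tau) + 45 * pi * expR 1) * D.
Proof.
have p0 := pi_gt0 R.
set L := - ln tau; have L0 : 0 <= L by rewrite oppr_ge0 ln_le0.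
set r := Num.sqrt _; have r1 : 1 <= r by rewrite /r -{1}sqrtr1 ler_sqrt; rewrite -/L;
  lra.
have r2 : r ^+ 2 = 1 + L by rewrite sqr_sqrtr// -/L; lra.
set C := 45 * pi * expR 1; have C0 : 0 <= C by rewrite !mulr_ge0 ?expR_ge0 ?(ltW p0).
have [wr|rw] := leP w r.
  apply: (@le_trans _ _ (r * D)); last by rewrite ler_wpM2r ?(ltW D_gt0)//; lra.
  by rewrite ler_pM ?subr_ge0// gerBl.
have w1 : 1 <= w by lra.
have wp : 0 < w by lra.
have := @DN_split (2 * r / w); rewrite divr_ge0 ?mulr_ge0//; last by lra.
move=> /(_ isT) h1; have h2 := D_ge_tail w1.
have -> : (2 * r + C) * D = w * (2 * r / w * D) + C * D by field; rewrite gt_eqF.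
apply: le_trans (ler_wpM2l w0 h1) _; rewrite mulrDr lerD2l.
apply: le_trans (ler_wpM2l C0 h2).
have -> : w ^+ 2 * (2 * r / w) = 2 * r * w by field; rewrite gt_eqF.
have tauE : tau = expR (- L) by rewrite /L opprK lnK.
have -> : C * (c0 * tau * expR (-1) * 2 / (15 * pi * w ^+ 2)) = c0 * (6 * tau / w ^+ 2).
  rewrite /C expRN; move: (pi : R) p0 => p p0.
  by field; rewrite !gt_eqF ?expR_gt0.
rewrite mulrCA ler_wpM2l ?(ltW c00)// ler_pdivlMr ?exprn_gt0// mulrAC -exprS.
have h3 : expR (- (2 * r * w)) <= tau * expR (- w).
  rewrite tauE -expRD ler_expR; nra.
apply: (@le_trans _ _ (w ^+ 3 * (tau * expR (- w))));
  first by rewrite ler_wpM2l ?exprn_ge0.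
rewrite mulrCA [leRHS]mulrC ler_wpM2l ?(ltW tau0)// expRN ler_pdivrMr ?expR_gt0//.
have := @expR_ge1Dxn R w 2 w0; rewrite (_ : 3`! = 6%N)//; lra.
Qed.

Let meanE : horseshoe_mean sigma tau y = y * (N / D).
Proof. exact: horseshoe_meanE. Qed.

Lemma horseshoe_mean_sqr_le : horseshoe_mean sigma tau y ^+ 2 <= y ^+ 2.
Proof.
rewrite meanE exprMn ler_piMr ?sqr_ge0// expr_le1 ?divr_ge0 ?(ltW D_gt0)//.
by rewrite ler_pdivrMr// mul1r.
Qed.

(** Near 0 the estimator is of order tau: w N <= c0 tau, while D is at least a
    multiple of e^(-w^2). *)
Lemma horseshoe_mean_shrunk :
  `|horseshoe_mean sigma tau y| <= 4 * pi * sigma * tau * expR (scaled_abs y ^+ 2).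
Proof.
have p0 := pi_gt0 R; rewrite -wE.
rewrite meanE normrM normr_scaled_abs -wE ger0_norm ?divr_ge0 ?(ltW D_gt0)//.
rewrite mulrA ler_pdivrMr//.
rewrite (_ : _ * N = sigma * Num.sqrt 2 * (w * N)); last by ring.
apply: (@le_trans _ _ (sigma * 2 * (c0 * tau))).
  apply: ler_pM => //; rewrite ?mulr_ge0 ?sqrtr_ge0 ?(ltW sigma0)//.
  by rewrite ler_wpM2l ?(ltW sigma0)// -ler_sqr ?nnegrE ?sqrtr_ge0// sqr_sqrtr//; lra.
apply: le_trans (ler_wpM2l _ D_ge_exp); last first.
  by rewrite !mulr_ge0 ?expR_ge0 ?(ltW sigma0) ?(ltW tau0) ?(ltW p0).
rewrite expRN; have E0 := expR_gt0 (w ^+ 2).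
move: (pi : R) (expR _) p0 E0 => p E p0 E0.
rewrite le_eqVlt; apply/orP; left; apply/eqP.
by field; rewrite !gt_eqF.
Qed.

(** The bias y - T_tau(y) is y (D - N) / D, hence the bound on w (D - N). *)
Lemma horseshoe_mean_bias :
  (horseshoe_mean sigma tau y - y) ^+ 2 <=
  2 * sigma ^+ 2 * (2 + 45 * pi * expR 1) ^+ 2 * (1 - ln tau).
Proof.
have p0 := pi_gt0 R.
have -> : (horseshoe_mean sigma tau y - y) ^+ 2
  = 2 * sigma ^+ 2 * (w * (D - N) / D) ^+ 2.
  have -> : 2 = Num.sqrt 2 ^+ 2 :> R by rewrite sqr_sqrtr.
  rewrite meanE -exprMn -[LHS]ger0_norm ?sqr_ge0// normrX.
  rewrite (_ : y * (N / D) - y = - (y * ((D - N) / D))); last by field; rewrite gt_eqF.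
  rewrite normrN normrM normr_scaled_abs -wE (ger0_norm (_ : 0 <= (D - N) / D));
    last first.
    by rewrite divr_ge0 ?subr_ge0// ltW.
  rewrite -exprMn; congr (_ ^+ 2); ring.
rewrite -[leRHS]mulrA ler_wpM2l ?mulr_ge0 ?(ltW sigma0)//.
set L := - ln tau; have L0 : 0 <= L by rewrite oppr_ge0 ln_le0.
set r := Num.sqrt (1 - ln tau); have r1 : 1 <= r by rewrite /r -{1}sqrtr1 ler_sqrt;
  rewrite -/L; lra.
have -> : 1 + L = r ^+ 2 by rewrite sqr_sqrtr// -/L; lra.
rewrite -exprMn ler_sqr ?nnegrE ?divr_ge0 ?mulr_ge0 ?subr_ge0 ?(ltW D_gt0)//;
  last 2 first.
- by rewrite addr_ge0// !mulr_ge0 ?expR_ge0 ?(ltW p0).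
- by lra.
rewrite ler_pdivrMr//; apply: le_trans wDN_le _; rewrite ler_wpM2r ?(ltW D_gt0)//.
rewrite -/L -/r [leRHS]mulrDl lerD2l ler_peMr// !mulr_ge0 ?expR_ge0 ?(ltW p0)//.
Qed.
End fixed_tau.
End posterior_bounds.

(** * Integration against a normal law *)

Section integral_tools.
Context {R : realType}.
Local Notation mu := (@lebesgue_measure R).
Import HBNNSimple.

(** The integral of a nonnegative function is a supremum over the simple functions
    below it, hence monotone for nonmeasurable f as well. So the loss at a
    data-dependent tau can be compared directly with measurable bounds. *)
Lemma le_integral_dominated d (T : measurableType d) (m : {measure set T -> \bar R})
    (f g : T -> \bar R) : (forall x, 0 <= f x)%E -> (forall x, f x <= g x)%E ->
  (\int[m]_x f x <= \int[m]_x g x)%E.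
Proof.
move=> f0 fg; have g0 x : (0 <= g x)%E by exact: le_trans (fg x).
rewrite !ge0_integralTE//; apply: ereal_sup_le => _ [h hf <-].
by exists h => // x; exact: le_trans (fg x).
Qed.

Section density.
Variables (m s : R).
Local Notation P := (normal_prob m s).

Let integral_normal_indic (A : set R) : measurable A ->
  (\int[P]_x (\1_A x)%:E = \int[mu]_x ((\1_A x)%:E * (normal_pdf m s x)%:E))%E.
Proof.
move=> mA; rewrite integral_indic// setIT /normal_prob [LHS]integral_mkcond/=.
apply: eq_integral => x _; rewrite /patch indicE; case: ifPn; rewrite ?mul1e ?mul0e//.
Qed.

Let integral_normal_nnsfun (h : {nnsfun (measurableTypeR R) >-> R}) :
  (\int[P]_x (h x)%:E = \int[mu]_x ((h x)%:E * (normal_pdf m s x)%:E))%E.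
Proof.
under [LHS]eq_integral do rewrite fimfunE -fsumEFin//.
rewrite [LHS]ge0_integral_fsum//; last 2 first.
  - by move=> r; apply/measurable_EFinP; apply: measurable_funM => //;
    apply: measurable_indic; rewrite -[X in measurable X]setTI; exact: measurable_funPT.
  - by move=> n x _; rewrite EFinM nnfun_muleindic_ge0.
under [RHS]eq_integral.
  move=> x xD; rewrite fimfunE -fsumEFin// ge0_mule_fsuml; last first.
    by move=> r; rewrite EFinM nnfun_muleindic_ge0.
  over.
rewrite [RHS]ge0_integral_fsum//; last 2 first.
  - move=> r; apply: emeasurable_funM; apply/measurable_EFinP;
    first by apply: measurable_funM => //; apply: measurable_indic;
    rewrite -[X in measurable X]setTI; exact: measurable_funPT.
    exact: measurable_normal_pdf.
  - by move=> n x _; rewrite mule_ge0 ?lee_fin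
    ?normal_pdf_ge0// -lee_fin EFinM nnfun_muleindic_ge0.
apply: eq_fsbigr => r _.
under [RHS]eq_integral do rewrite EFinM -muleA.
have mI : measurable (h @^-1` [set r]) by rewrite -[X in measurable X]setTI;
  exact: measurable_funPT.
have [r0|r0] := leP 0 r.
  under [LHS]eq_integral do rewrite EFinM.
  rewrite [LHS]ge0_integralZl// ?[RHS]ge0_integralZl ?integral_normal_indic//=.
  - by apply: emeasurable_funM; apply/measurable_EFinP;
    [exact: measurable_indic|exact: measurable_normal_pdf].
  - by move=> x _; rewrite mule_ge0// lee_fin// normal_pdf_ge0.
  - by apply/measurable_EFinP; exact: measurable_indic.
have h0 : h @^-1` [set r] = set0.
  by apply/seteqP; split => // x /= hx; have : 0 <= h x by []; rewrite hx leNgt r0.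
by rewrite h0; apply: eq_trans (esym _); apply: integral0_eq => x _;
  rewrite indic0 ?mulr0 ?mul0e ?mule0.
Qed.

Lemma ge0_integral_normal_prob (f : _ -> \bar R) : measurable_fun setT f ->
  (forall x, 0 <= f x)%E ->
  (\int[P]_x f x = \int[mu]_x (f x * (normal_pdf m s x)%:E))%E.
Proof.
move=> mf f0; pose f_ := nnsfun_approx measurableT mf.
have p0 x : (0 <= (normal_pdf m s x)%:E)%E by rewrite lee_fin normal_pdf_ge0.
transitivity (limn (fun n => \int[P]_x (f_ n x)%:E)%E).
  rewrite -monotone_convergence//=.
  - apply: eq_integral => x /[!inE] xD; apply/esym/cvg_lim => //=.
    exact: cvg_nnsfun_approx.
  - by move=> n; exact/measurable_EFinP/measurable_funTS.
  - by move=> n ? _; rewrite lee_fin.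
  - by move=> ? _ a b ab; rewrite lee_fin; exact/lefP/nd_nnsfun_approx.
under eq_fun do rewrite integral_normal_nnsfun.
rewrite -monotone_convergence//=.
- apply: eq_integral => x /[!inE] xD; apply: cvg_lim => //.
  apply: cvgeMr => //; exact: cvg_nnsfun_approx.
- move=> n; apply: emeasurable_funM; apply/measurable_EFinP;
  first exact: measurable_funPT.
  exact: measurable_normal_pdf.
- by move=> n x _; rewrite mule_ge0// lee_fin.
- by move=> x _ a b ab; rewrite lee_pmul// lee_fin//; exact/lefP/nd_nnsfun_approx.
Qed.
End density.
End integral_tools.

(** * Gaussian moments and truncated moments *)

Section gaussian_moments.
Context {R : realType}.
Local Notation mu := (@lebesgue_measure R).

Lemma normal_prob_second_moment (m s : R) : 0 < s ->
  (\int[normal_prob m s]_t ((t - m) ^+ 2)%:E <= (8 * s ^+ 2)%:E)%E.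
Proof.
move=> s0; rewrite ge0_integral_normal_prob; last 2 first.
- by apply/measurable_EFinP; apply: measurable_funX; exact: measurable_funB.
- by move=> t; rewrite lee_fin sqr_ge0.
apply: (@le_trans _ _ (\int[mu]_t ((8 * s ^+ 2)%:E * (normal_pdf m (2 * s) t)%:E))%E).
  apply: le_integral_dominated => t;
    first by rewrite mule_ge0 ?lee_fin ?sqr_ge0 ?normal_pdf_ge0.
  by rewrite -!EFinM lee_fin; exact: normal_pdf_wider.
rewrite ge0_integralZl_EFin ?integral_normal_pdf ?mule1 ?mulr_ge0 ?(ltW s0)//.
- by move=> t _; rewrite lee_fin normal_pdf_ge0.
- by apply/measurable_EFinP; exact: measurable_normal_pdf.
Qed.

Lemma normal_prob_near_mean (m s : R) : 0 < s ->
  ((2 * s * (normal_peak s * expR (-1)))%:E <= normal_prob m s [set t | `|t - m|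
    <= s]%R)%E.
Proof.
move=> s0; rewrite /normal_prob.
have -> : [set t | `|t - m| <= s] = `[m - s, m + s]%classic.
  by apply/seteqP; split=> t /=; rewrite in_itv/= ler_distl.
apply: (@le_trans _ _ (\int[mu]_(t in `[(m - s)%R, (m
  + s)%R]) cst (normal_peak s * expR (-1))%:E t)%E).
  rewrite integral_cst//= lebesgue_measure_itv/= lte_fin ifT; last by lra.
  by rewrite -EFinB -EFinM lee_fin le_eqVlt; apply/orP; left; apply/eqP; ring.
apply: ge0_le_integral => //=.
- by move=> t _; rewrite lee_fin mulr_ge0 ?normal_peak_ge0 ?expR_ge0.
- by apply/measurable_EFinP; apply: measurable_funTS; exact: measurable_normal_pdf.
move=> t; rewrite in_itv/= => /andP[t1 t2].
rewrite lee_fin normal_pdf_expE ?gt_eqF// ler_wpM2l ?normal_peak_ge0// ler_expR.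
rewrite mulNr lerN2 ler_pdivrMr ?pmulrn_lgt0 ?exprn_gt0// mul1r; nra.
Qed.

Section tail.
Variables (s z : R) (s0 : 0 < s) (z0 : 0 < z) (sz : 2 * s ^+ 2 <= z ^+ 2).
(* F is the primitive of f, and f dominates t^2 E beyond z because 2 s^2 <= z^2 *)
Let E (t : R) := expR (- (t ^+ 2 / (2 * s ^+ 2))).
Let f (t : R) := 2 * (t ^+ 2 - s ^+ 2) * E t.
Let F (t : R) := - (2 * s ^+ 2) * (t * E t).

Let dE (t : R) : is_derive t 1 E (- (t / s ^+ 2) * E t).
Proof.
have di : is_derive t 1 (fun u : R => (- (2 * s ^+ 2)^-1) *: (u ^+ 2)) (- (t / s ^+ 2)).
  apply: is_derive_eq; rewrite /GRing.scale/=.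
  by field; rewrite gt_eqF.
have := is_derive1_comp (is_derive_expR _) di.
rewrite (_ : _ \o _ = E); last first.
  by apply/funext => u; rewrite /E/= /GRing.scale/= mulNr mulrC.
move=> h; apply: is_derive_eq h _.
by rewrite mulrC; congr (_ * expR _); rewrite /GRing.scale/= mulNr mulrC.
Qed.

Let dF (t : R) : is_derive t 1 F (f t).
Proof.
have dm := is_deriveM (is_derive_id t 1) (dE t).
have := is_deriveZ (- (2 * s ^+ 2)) dm.
move=> h; apply: is_derive_eq h _.
by rewrite /f /GRing.scale/=; field; rewrite gt_eqF.
Qed.

Let cE : continuous E.
Proof.
move=> t; apply: differentiable_continuous; apply/derivable1_diffP.
by have [] := dE t.
Qed.

Let F0 : F t @[t --> +oo] --> (0 : R).
Proof.
have hV : (fun t : R => t^-1) @ +oo --> (0 : R).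
  by apply/gtr0_cvgV0; [exact: nbhs_pinfty_gt|exact: cvg_id].
apply: (@squeeze_cvgr _ _ _ _ (fun t => - (4 * s ^+ 4) * t^-1) (fun=> 0)).
- near=> t; have t0 : 0 < t by near: t; exact: nbhs_pinfty_gt.
  rewrite /F; apply/andP; split; last
    by rewrite mulNr oppr_le0 !mulr_ge0 ?expR_ge0 ?(ltW s0) ?ltW.
  rewrite !mulNr lerN2 ler_pdivlMr// /E expRN.
  have v0 : 0 < 2 * s ^+ 2 by rewrite mulr_gt0 ?exprn_gt0.
  set v := t ^+ 2 / (2 * s ^+ 2).
  have -> : 2 * s ^+ 2 * (t / expR v) * t = (2 * s ^+ 2) * ((2 * s ^+ 2 * v) / expR v).
    by rewrite /v; field; rewrite !gt_eqF ?expR_gt0.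
  have -> : 4 * s ^+ 4 = (2 * s ^+ 2) * (2 * s ^+ 2) by ring.
  rewrite ler_pM2l// ler_pdivrMr ?expR_gt0// ler_pM2l//.
  by apply: le_trans (expR_ge1Dx _); rewrite lerDr.
- by rewrite -[X in _ --> X](mulr0 (- (4 * s ^+ 4))); apply: cvgM; [exact: cvg_cst|].
- exact: cvg_cst.
Unshelve. all: by end_near. Qed.

Let tail_right :
  (\int[mu]_(t in `[z, +oo[) (t ^+ 2 * E t)%:E <= (2 * s ^+ 2 * z * E z)%:E)%E.
Proof.
have z2 t : z <= t -> z ^+ 2 <= t ^+ 2.
  by move=> zt; rewrite lerXn2r ?nnegrE ?(ltW z0)// (le_trans (ltW z0)).
have h2 (a b : R) : 2 * b <= a -> a <= 2 * (a - b) by lra.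
have h3 (a b : R) : 0 <= b -> 2 * b <= a -> 0 <= 2 * (a - b) by lra.
have cf : continuous f.
  move=> t; apply: cvgM; last exact: cE.
  apply: cvgM; first exact: cvg_cst.
  by apply: cvgB; [exact: exprn_continuous|exact: cvg_cst].
apply: (@le_trans _ _ (\int[mu]_(t in `[z, +oo[) (f t)%:E)%E).
  apply: ge0_le_integral => //=.
  - by move=> t _; rewrite lee_fin mulr_ge0 ?sqr_ge0 ?expR_ge0.
  - apply/measurable_EFinP; apply: measurable_funTS; apply: measurable_funM.
      exact: measurable_funX.
    exact: continuous_measurable_fun.
  - by apply/measurable_EFinP; apply: measurable_funTS;
    exact: continuous_measurable_fun.
  move=> t; rewrite in_itv/= andbT => zt.
  have t2 := z2 _ zt; rewrite lee_fin /f; apply: ler_wpM2r; first exact: expR_ge0.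
  by apply: h2; exact: le_trans sz t2.
rewrite (@ge0_continuous_FTC2y _ f F z 0).
- by rewrite sub0e -EFinN lee_fin /F; rewrite le_eqVlt; apply/orP; left; apply/eqP;
  ring.
- move=> t zt; apply: mulr_ge0; last exact: expR_ge0.
  by apply: h3; [exact: sqr_ge0|exact: le_trans sz (z2 _ zt)].
- exact: continuous_subspaceT.
- exact: F0.
- by move=> t _; have [] := dF t.
- apply: cvg_at_right_filter.
  suff : {for z, continuous F} by [].
  by apply: differentiable_continuous; apply/derivable1_diffP; have [] := dF z.
- by move=> t _; rewrite derive1E; have [_ ->] := dF t.
Qed.

Let tail_left :
  (\int[mu]_(t in `]-oo, (- z)%R]) (t ^+ 2 * E t)%:E <= (2 * s ^+ 2 * z * E z)%:E)%E.
Proof.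
rewrite ge0_integration_by_substitutionNy.
- rewrite [X in (X <= _)%E](_ : _ = \int[mu]_(t in `[z, +oo[) (t ^+ 2 * E t)%:E)%E;
  first exact: tail_right.
  by apply: eq_integral => t _ /=; rewrite /E sqrrN.
- apply: continuous_subspaceT => t; apply: cvgM; last exact: cE.
  exact: exprn_continuous.
- by move=> t _; rewrite mulr_ge0 ?sqr_ge0 ?expR_ge0.
Qed.
(** On [-z, z] the growth e^(t^2 / s^2) is only half compensated by the density,
    and the integrand is bounded by its value at z; beyond z this is the second
    moment of the Gaussian tail. *)
Lemma normal_prob_truncated_moment (a : R) : 0 <= a ->
  (\int[normal_prob 0 s]_t
     (if (`|t| <= z)%R then a * expR (t ^+ 2 / s ^+ 2) else t ^+ 2)%:E <=
   (normal_peak s * z * (2 * a * expR (z ^+ 2 / (2 * s ^+ 2)) +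
     4 * s ^+ 2 * expR (- (z ^+ 2 / (2 * s ^+ 2)))))%:E)%E.
Proof.
move=> a0; set c := normal_peak s; have c0 : 0 <= c := normal_peak_ge0 _.
have pE t : normal_pdf 0 s t = c * E t.
  by rewrite normal_pdf_expE ?gt_eqF// subr0 /E mulNr -mulr_natl.
have cg : continuous (fun t : R => t ^+ 2 * E t).
  by move=> t; apply: cvgM; [exact: exprn_continuous|exact: cE].
have mg : measurable_fun setT (fun t : R => (t ^+ 2 * E t)%:E).
  by apply/measurable_EFinP; exact: continuous_measurable_fun.
have g0 (t : R) : (0 <= (t ^+ 2 * E t)%:E)%E
  by rewrite lee_fin mulr_ge0 ?sqr_ge0 ?expR_ge0.
rewrite ge0_integral_normal_prob; last 2 first.
- apply/measurable_EFinP; apply: measurable_fun_ifT.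
  + by apply: measurable_fun_ler => //; exact: measurableT_comp.
  + apply: measurable_funM => //; apply: (measurableT_comp (f := expR));
    first exact: measurable_expR.
    by apply: measurable_funM => //; exact: measurable_funX.
  + exact: measurable_funX.
- move=> t; rewrite lee_fin; case: ifP => _; last exact: sqr_ge0.
  by rewrite mulr_ge0 ?expR_ge0.
pose M := c * a * expR (z ^+ 2 / (2 * s ^+ 2)).
have M0 : 0 <= M by rewrite !mulr_ge0 ?expR_ge0.
pose D1 := `[- z, z]%classic : set R.
pose D2 := `[z, +oo[%classic : set R.
pose D3 := `]-oo, - z]%classic : set R.
pose g (t : R) := (t ^+ 2 * E t)%:E.
pose B (t : R) := (((cst M%:E) \_ D1) t + (c%:E * ((g \_ D2) t + (g \_ D3) t)))%E.
have p1 (t : R) : (0 <= ((cst M%:E) \_ D1) t)%E by rewrite /patch; case: ifP => // _;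
  rewrite lee_fin.
have p2 (D : set R) (t : R) : (0 <= (g \_ D) t)%E by rewrite /patch;
  case: ifP => // _; exact: g0.
apply: (@le_trans _ _ (\int[mu]_t B t)%E).
  apply: le_integral_dominated => t.
    rewrite -EFinM lee_fin mulr_ge0 ?normal_pdf_ge0//.
    by case: ifP => _; [rewrite mulr_ge0 ?expR_ge0|exact: sqr_ge0].
  rewrite -EFinM pE /B; case: ifPn => [tz|].
    rewrite [X in (X + _)%E](_ : _ = M%:E); last first.
      by rewrite /patch mem_set// /D1/= in_itv/= -ler_norml.
    apply: (@le_trans _ _ M%:E); last by rewrite leeDl// mule_ge0 ?adde_ge0.
    have -> : a * expR (t ^+ 2 / s ^+ 2) * (c * E t)
      = c * a * expR (t ^+ 2 / (2 * s ^+ 2)).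
      rewrite (_ : t ^+ 2 / (2 * s ^+ 2) = t ^+ 2 / s ^+ 2 + - (t ^+ 2 / (2 * s ^+ 2))).
        by rewrite expRD /E; ring.
      by field; rewrite gt_eqF.
    rewrite lee_fin /M ler_wpM2l ?mulr_ge0// ler_expR ler_pM2r ?invr_gt0 ?mulr_gt0
      ?exprn_gt0//.
    by rewrite -(ger0_norm (sqr_ge0 t)) normrX lerXn2r ?nnegrE// ltW.
  rewrite -ltNge => zt; apply: (@le_trans _ _ (c%:E * g t)%E).
    by rewrite /g -EFinM lee_fin mulrCA.
  apply: (@le_trans _ _ (c%:E * ((g \_ D2) t + (g \_ D3) t))%E); last by rewrite leeDr.
  apply: lee_wpmul2l; first by rewrite lee_fin.
  move: zt; rewrite lter_normr => /orP[|] h.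
    rewrite [X in (_ <= X + _)%E](_ : _ = g t) ?leeDl//.
    by rewrite /patch mem_set// /D2/= in_itv/= andbT ltW.
  rewrite [X in (_ <= _ + X)%E](_ : _ = g t) ?leeDr//.
  by rewrite /patch mem_set// /D3/= in_itv/= lerNr ltW.
have mg' D : measurable D -> measurable_fun setT (g \_ D).
  by move=> mD; apply/(measurable_restrictT _ mD); exact: measurable_funTS.
have mD1 : measurable D1 by exact: measurable_itv.
have mD2 : measurable D2 by exact: measurable_itv.
have mD3 : measurable D3 by exact: measurable_itv.
rewrite /B ge0_integralD//; last 3 first.
- by apply/(measurable_restrictT _ mD1).
- by move=> t _; rewrite mule_ge0 ?adde_ge0.
- by apply: emeasurable_funM => //; apply: emeasurable_funD; exact: mg'.
rewrite ge0_integralZl//; last 2 first.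
- by apply: emeasurable_funD; exact: mg'.
- by move=> t _; rewrite adde_ge0.
rewrite ge0_integralD//; [|exact: mg'|exact: mg'].
have lD1 : lebesgue_measure D1 = (z - - z)%:E.
  by rewrite /D1 lebesgue_measure_itv/= lte_fin (_ : (- z < z)
    = true)// -subr_gt0 opprK addr_gt0.
rewrite -!integral_mkcond integral_cst//.
rewrite [X in (_ * X + _ <= _)%E](_ : _ = (z - - z)%:E); last exact: lD1.
rewrite -EFinM.
apply: (@le_trans _ _ ((M * (z - - z))%:E + c%:E * ((2 * s ^+ 2 * z * E z)%:E
  + (2 * s ^+ 2 * z * E z)%:E))%E).
  apply: leeD => //; apply: lee_wpmul2l; first by rewrite lee_fin.
  exact: leeD tail_right tail_left.
rewrite lee_fin /M /E le_eqVlt; apply/orP; left; apply/eqP; ring.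
Qed.
End tail.
End gaussian_moments.

(** * The loss in one coordinate *)

Section coordinatewise_loss.
Context {R : realType}.
Variables (sigma : R) (sigma0 : 0 < sigma).

Lemma normal_vec_coord n (theta : n.-tuple R) (i : 'I_n) (A : set R) : measurable A ->
  normal_vec sigma theta [set y | A (tnth y i)] = normal_prob (tnth theta i) sigma A.
Proof.
move=> mA; pose B j := if j == i then A else setT.
have mB j : measurable (B j) by rewrite /B; case: ifP.
rewrite (_ : [set y | _] = [set y | forall j, B j (tnth y j)]); last first.
  apply/seteqP; split => [y yA j|y /(_ i)]; rewrite /B ?eqxx//.
  by case: eqP => [->|].
rewrite (normal_vec_box sigma theta mB) (bigD1 i)//= {1}/B eqxx big1 ?mule1// => j ji.
by rewrite /B (negbTE ji); exact: probability_setT.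
Qed.

Lemma ge0_integral_coord n (theta : n.-tuple R) (i : 'I_n) (f : measurableTypeR R
  -> \bar R) :
  measurable_fun setT f -> (forall x, 0 <= f x)%E ->
  (\int[normal_vec sigma theta]_y f (tnth y i) =
   \int[normal_prob (tnth theta i) sigma]_t f t)%E.
Proof.
move=> mf f0.
have mphi : measurable_fun setT ((fun y => tnth y i) : n.-tuple R
  -> measurableTypeR R) by exact: measurable_tnth.
rewrite -(@ge0_integral_pushforward _ _ _ _ _ _ mphi (normal_vec sigma theta) setT f)//.
apply: eq_measure_integral => A mA _; exact: normal_vec_coord.
Qed.

Lemma l2norm_sqr n (x : n.-tuple R) : l2norm x ^+ 2 = \sum_(i < n) tnth x i ^+ 2.
Proof. by rewrite sqr_sqrtr// sumr_ge0// => i _; rewrite sqr_ge0. Qed.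

Lemma loss_sum n (t : R) (y theta : n.-tuple R) :
  l2norm (vsub (horseshoe_estimator sigma t y) theta) ^+ 2 =
  \sum_(i < n) (horseshoe_mean sigma t (tnth y i) - tnth theta i) ^+ 2.
Proof. by rewrite l2norm_sqr; apply: eq_bigr => i _; rewrite !tnth_mktuple. Qed.

Definition bias_const : R := 2 * sigma ^+ 2 * (2 + 45 * pi * expR 1) ^+ 2.

Lemma bias_const_ge0 : 0 <= bias_const.
Proof. by rewrite mulr_ge0 ?sqr_ge0// mulr_ge0 ?sqr_ge0. Qed.

(** T - th = (T - y) + (y - th): the bias of the estimator plus the noise. *)
Lemma loss_le_bias_noise (t y th : R) : 0 < t -> t <= 1 ->
  (horseshoe_mean sigma t y - th) ^+ 2
    <= 2 * bias_const * (1 - ln t) + 2 * (y - th) ^+ 2.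
Proof.
move=> t0 t1; have h := horseshoe_mean_bias sigma0 t0 t1 y.
rewrite -/bias_const in h.
rewrite -mulrA; set T := horseshoe_mean _ _ _ in h *; set K := bias_const * _ in h *.
have := sqr_ge0 ((T - y) - (y - th)); nra.
Qed.

(** A bound for the squared estimate at a zero mean, uniform over all global scales
    up to t: the shrinkage bound below the threshold z, the trivial bound
    T^2 <= x^2 above it. *)
Definition null_bound (t z x : R) : R :=
  if `|x| <= z then (4 * pi * sigma * t) ^+ 2 * expR (x ^+ 2 / sigma ^+ 2) else x ^+ 2.

Lemma null_bound_ge0 t z x : 0 <= null_bound t z x.
Proof. by rewrite /null_bound; case: ifP => _; [apply: mulr_ge0;
  [exact: sqr_ge0|exact: expR_ge0]|exact: sqr_ge0]. Qed.

Lemma measurable_null_bound t z : measurable_fun setT (null_bound t z).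
Proof.
apply: measurable_fun_ifT.
- by apply: measurable_fun_ler => //; exact: measurableT_comp.
- apply: measurable_funM => //; apply: (measurableT_comp (f := expR));
  first exact: measurable_expR.
  by apply: measurable_funM => //; exact: measurable_funX.
- exact: measurable_funX.
Qed.

(** A scale t > u gives up shrinkage, but then the loss below the threshold is at
    most z^2 anyway. *)
Lemma loss_le_null_bound (t u z y : R) : 0 < t -> t <= 1 -> 0 <= u -> 0 <= z ->
  horseshoe_mean sigma t y ^+ 2 <= null_bound u z y + z ^+ 2 * (u < t)%R%:R.
Proof.
move=> t0 t1 u0 z0; have p0 := pi_gt0 R.
have hT := horseshoe_mean_sqr_le sigma0 t0 t1 y.
rewrite /null_bound; case: ifPn => [yz|yz]; last first.
  by apply: le_trans hT _; rewrite lerDl mulr_ge0 ?sqr_ge0.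
have [tu|ut] := leP t u.
  rewrite mulr0 addr0.
  have := horseshoe_mean_shrunk sigma0 t0 t1 y => h.
  have -> : y ^+ 2 / sigma ^+ 2 = scaled_abs sigma y ^+ 2 + scaled_abs sigma y ^+ 2.
    by rewrite scaled_abs_sqr; field; rewrite gt_eqF.
  rewrite expRD -expr2 -exprMn -[leLHS]ger0_norm ?sqr_ge0// normrX lerXn2r ?nnegrE//.
    by rewrite !mulr_ge0 ?expR_ge0 ?(ltW p0) ?(ltW sigma0).
  apply: le_trans h _; rewrite ler_wpM2r ?expR_ge0// ler_wpM2l// !mulr_ge0 ?(ltW p0)
    ?(ltW sigma0)//.
rewrite mulr1; apply: le_trans hT _; rewrite -[leLHS]ger0_norm ?sqr_ge0// normrX.
apply: (@le_trans _ _ (z ^+ 2)); first by rewrite lerXn2r ?nnegrE.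
by rewrite lerDr mulr_ge0 ?sqr_ge0 ?expR_ge0.
Qed.

(** The threshold where e^(-z^2 / (2 sigma^2)) = u, which balances the two parts of
    the null risk. *)
Definition universal_threshold (u : R) : R := sigma * Num.sqrt (2 * - ln u).

Lemma universal_threshold_sqr u : u <= 1
  -> universal_threshold u ^+ 2 = 2 * sigma ^+ 2 * - ln u.
Proof.
move=> u1; rewrite exprMn sqr_sqrtr; first by ring.
by rewrite mulr_ge0// oppr_ge0 ln_le0.
Qed.

Definition null_const : R := normal_peak sigma * (32 * pi ^+ 2 * sigma ^+ 2
  + 4 * sigma ^+ 2).

Lemma null_const_ge0 : 0 <= null_const.
Proof.
apply: mulr_ge0; first exact: normal_peak_ge0.
by rewrite addr_ge0// mulr_ge0 ?sqr_ge0// mulr_ge0 ?sqr_ge0.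
Qed.

Lemma null_risk (u : R) : 0 < u -> u <= expR (-1) ->
  (\int[normal_prob 0 sigma]_t (null_bound u (universal_threshold u) t)%:E <=
   (null_const * (u * universal_threshold u))%:E)%E.
Proof.
move=> u0 u1.
have lnu : 1 <= - ln u by rewrite lerNr -[leRHS]expRK ler_ln ?posrE ?expR_gt0.
have ul1 : u <= 1 by apply: le_trans u1 _; rewrite expR_le1; lra.
set z := universal_threshold u.
have z2 : z ^+ 2 = 2 * sigma ^+ 2 * - ln u := universal_threshold_sqr ul1.
have z0 : 0 < z by rewrite mulr_gt0// sqrtr_gt0 mulr_gt0//; lra.
have zs : 2 * sigma ^+ 2 <= z ^+ 2 by rewrite z2 ler_peMr// mulr_ge0 ?sqr_ge0.
have a0 : 0 <= (4 * pi * sigma * u) ^+ 2 by rewrite sqr_ge0.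
apply: le_trans (normal_prob_truncated_moment sigma0 z0 zs a0) _.
have -> : z ^+ 2 / (2 * sigma ^+ 2) = - ln u by rewrite z2; field; rewrite gt_eqF.
rewrite expRN opprK lnK ?posrE// lee_fin /null_const.
move: (pi : R) => q; rewrite le_eqVlt; apply/orP; left; apply/eqP.
by field; rewrite gt_eqF.
Qed.
End coordinatewise_loss.

(** * Risk bounds at a fixed dimension *)

Section risk_bounds.
Context {R : realType}.
Variables (sigma : R) (sigma0 : 0 < sigma).
Local Notation bias_const := (bias_const sigma).
Local Notation null_const := (null_const sigma).
Local Notation threshold := (universal_threshold sigma).

Let lt_indicE n (t : n.-tuple R
  -> R) (u : R) y : (u < t y)%R%:R = \1_[set y | u < t y] y :> R.
Proof. by rewrite indicE; congr ((nat_of_bool _)%:R);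
  apply/idP/idP => [/mem_set|/set_mem]. Qed.

Let measurable_gt n (t : n.-tuple R -> R) (u : R) : measurable_fun setT t ->
  measurable [set y | u < t y].
Proof.
move=> mt; rewrite -[X in measurable X]setTI.
have := mt measurableT _ (@measurable_itv R `]u, +oo[).
by congr (measurable (_ `&` _)); apply/seteqP; split => y /=; rewrite in_itv/= andbT.
Qed.

(** The supremum over theta and the randomness of t enter only through J and q: the
    k nonzero coordinates cost the bias at t plus the noise, the others the null
    risk at level u plus the squared threshold on the event u < t. *)
Lemma risk_upper n k (theta : n.-tuple R) (t : n.-tuple R -> R) (u J q : R) :
  ell0 k theta -> measurable_fun setT t -> (forall y, 0 < t y <= 1) ->
  0 < u -> u <= expR (-1) ->
  (\int[normal_vec sigma theta]_y (1 - ln (t y))%:E <= J%:E)%E ->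
  (normal_vec sigma theta [set y | (u < t y)%R] <= q%:E)%E ->
  ('E_(normal_vec sigma theta)[fun y =>
     (l2norm (vsub (horseshoe_estimator sigma (t y) y) theta) ^+ 2)%R] <=
   (k%:R * (2 * bias_const * J + 16 * sigma ^+ 2) +
    n%:R * (null_const * (u * threshold u) + threshold u ^+ 2 * q))%:E)%E.
Proof.
move=> thk mt t01 u0 u1 hJ hq; set P := normal_vec sigma theta.
set z := threshold u.
have z0 : 0 <= z by rewrite mulr_ge0 ?sqrtr_ge0 ?ltW.
have K0 := bias_const_ge0 sigma; have N0 := null_const_ge0 sigma.
have lnt y : 0 <= 1 - ln (t y).
  by have /andP[_ ?] := t01 y; rewrite subr_ge0 (le_trans (ln_le0 _)).
have mlnt : measurable_fun setT (fun y => 1 - ln (t y)).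
  by apply: measurable_funB => //; apply: (measurableT_comp (f := @ln R)) => //.
have J0 : 0 <= J.
  by rewrite -lee_fin; apply: le_trans hJ; apply: integral_ge0 => y _; rewrite lee_fin.
have q0 : 0 <= q by rewrite -lee_fin; apply: le_trans hq; exact: measure_ge0.
pose a := 2 * bias_const * J + 16 * sigma ^+ 2.
pose b := null_const * (u * z) + z ^+ 2 * q.
have K2 : 0 <= 2 * bias_const by apply: mulr_ge0.
have a0 : 0 <= a.
  by apply: addr_ge0; apply: mulr_ge0 => //; exact: sqr_ge0.
have b0 : 0 <= b.
  apply: addr_ge0; apply: mulr_ge0 => //; last exact: sqr_ge0.
  by apply: mulr_ge0 => //; exact: ltW.
pose H (i : 'I_n) y : \bar R := if tnth theta i != 0
  then ((2 * bias_const)%:E * (1 - ln (t y))%:E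
    + 2%:E * ((tnth y i - tnth theta i) ^+ 2)%:E)%E
  else ((null_bound sigma u z (tnth y i))%:E
    + (z ^+ 2)%:E * (\1_[set y | (u < t y)%R] y)%:E)%E.
have mt' i : measurable_fun setT (fun y : n.-tuple R => tnth y i) := measurable_tnth i.
have ms i : measurable_fun setT (fun y : n.-tuple R
  => ((tnth y i - tnth theta i) ^+ 2)%:E).
  by apply/measurable_EFinP; apply: measurable_funX; exact: measurable_funB.
have mI : measurable_fun setT (fun y => (\1_[set y | u < t y] y : R)%:E).
  by apply/measurable_EFinP; apply: measurable_indic; exact: measurable_gt.
have mn i : measurable_fun setT (fun y : n.-tuple R
  => (null_bound sigma u z (tnth y i))%:E).
  apply/measurable_EFinP; apply: (measurableT_comp (f := null_bound sigma u z)) => //.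
  exact: measurable_null_bound.
have mH i : measurable_fun setT (H i).
  rewrite /H; case: (tnth theta i != 0).
    by apply: emeasurable_funD; apply: emeasurable_funM => //; apply/measurable_EFinP.
  by apply: emeasurable_funD => //; exact: emeasurable_funM.
have s0 (x : R) : (0 <= (x ^+ 2)%:E)%E by rewrite lee_fin sqr_ge0.
have n0 x : (0 <= (null_bound sigma u z x)%:E)%E by rewrite lee_fin null_bound_ge0.
have H0 i y : (0 <= H i y)%E.
  rewrite /H; case: ifP => _; apply: adde_ge0 => //; apply: mule_ge0 => //.
  by rewrite lee_fin.
have Hint i : (\int[P]_y H i y <= (if tnth theta i != 0%R then a else b)%:E)%E.
  rewrite /H; case: ifPn => [ti|/negPn/eqP ti].
    rewrite ge0_integralD//; last 4 first.
    - by move=> y _; rewrite mule_ge0 ?lee_fin.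
    - by apply: emeasurable_funM => //; apply/measurable_EFinP.
    - by move=> y _; rewrite mule_ge0.
    - exact: emeasurable_funM.
    rewrite !ge0_integralZl_EFin//; last 2 first.
    - by move=> y _; rewrite lee_fin.
    - exact/measurable_EFinP.
    have -> : a%:E = ((2 * bias_const)%:E * J%:E + 2%:E * (8 * sigma ^+ 2)%:E)%E.
      by rewrite -!EFinM -EFinD; congr EFin; rewrite /a; ring.
    apply: leeD; apply: lee_wpmul2l; rewrite ?lee_fin//.
    rewrite (@ge0_integral_coord R sigma n theta i (fun x
      => ((x - tnth theta i) ^+ 2)%:E))//.
      exact: normal_prob_second_moment.
    by apply/measurable_EFinP; apply: measurable_funX; exact: measurable_funB.
  rewrite ge0_integralD//; last 2 first.
  - by move=> y _; rewrite mule_ge0.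
  - exact: emeasurable_funM.
  rewrite ge0_integralZl_EFin ?sqr_ge0//.
  rewrite integral_indic// ?setIT; last exact: measurable_gt.
  rewrite /b EFinD [in X in (_ <= _ + X)%E]EFinM; apply: leeD;
    last by apply: lee_wpmul2l.
  have mnb : measurable_fun setT (fun x : measurableTypeR R
    => (null_bound sigma u z x)%:E).
    by apply/measurable_EFinP; exact: measurable_null_bound.
  by rewrite (ge0_integral_coord sigma theta i mnb n0) ti; exact: null_risk.
rewrite unlock; apply: (@le_trans _ _ (\int[P]_y \sum_(i < n) H i y)%E).
  apply: le_integral_dominated => y; first by rewrite lee_fin sqr_ge0.
  rewrite loss_sum -sumEFin; apply: lee_sum => i _.
  have /andP[t0 t1] := t01 y.
  rewrite /H; case: ifPn => [ti|/negPn/eqP ti].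
    by rewrite -!EFinM -EFinD lee_fin; exact: loss_le_bias_noise.
  by rewrite -EFinM -EFinD lee_fin ti subr0 -lt_indicE;
    apply: loss_le_null_bound => //; exact: ltW.
rewrite ge0_integral_sum//.
apply: (@le_trans _ _ (\sum_(i < n) ((tnth theta i != 0%R)%:R * a + b)%:E)%E).
  apply: lee_sum => i _; apply: le_trans (Hint i) _; rewrite lee_fin.
  by case: ifP => _; rewrite ?mul1r ?mul0r ?add0r ?lerDl.
rewrite sumEFin lee_fin big_split/=; apply: lerD; last first.
  by rewrite sumr_const card_ord -[leLHS]mulr_natl.
rewrite -mulr_suml; apply: ler_wpM2r => //; rewrite -natr_sum ler_nat.
by rewrite -big_mkcond/= sum1_card.
Qed.

(** Above u, log (1 / t) is at most log (1 / u); below u it is almost surely at most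
    log (1 / g), and v bounds the product with the probability of that event. *)
Lemma log_integral_underestimate n (theta : n.-tuple R) (t : n.-tuple R -> R)
    (u g l v : R) :
  measurable_fun setT t -> (forall y, 0 < t y < 1) -> 0 < u -> 0 < g < 1 -> 0 <= l ->
  - ln u <= l ->
  (normal_vec sigma theta [set y | (g <= t y)%R] = 1)%E ->
  ((- ln g)%:E * normal_vec sigma theta [set y | (t y <= u)%R] <= v%:E)%E ->
  (\int[normal_vec sigma theta]_y (1 - ln (t y))%:E <= (1 + l + v)%:E)%E.
Proof.
move=> mt t01 u0 /andP[g0 g1] l0 ul Pg hv; set P := normal_vec sigma theta.
have g0' : 0 <= - ln g by rewrite oppr_ge0 ln_le0// ltW.
have mU : measurable [set y | (t y <= u)%R].
  rewrite (_ : [set y | _] = ~` [set y | u < t y]); first by apply: measurableC;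
    exact: measurable_gt.
  by apply/seteqP; split => y /=; rewrite leNgt => /negP.
have mG : measurable [set y | (g <= t y)%R].
  rewrite -[X in measurable X]setTI.
  have := mt measurableT _ (@measurable_itv R `[g, +oo[).
  by congr (measurable (_ `&` _)); apply/seteqP; split => y /=; rewrite in_itv/= andbT.
have mI : measurable_fun setT (fun y => (\1_[set y | (t y <= u)%R] y : R)%:E).
  by apply/measurable_EFinP; exact: measurable_indic.
pose G y := ((1 + l)%:E + (- ln g)%:E * (\1_[set y | (t y <= u)%R] y)%:E)%E.
have G0 y : (0 <= G y)%E.
  by apply: adde_ge0; [rewrite lee_fin addr_ge0|apply: mule_ge0].
have mG' : measurable_fun setT G.
  by apply: emeasurable_funD => //; exact: emeasurable_funM.
apply: (@le_trans _ _ (\int[P]_y G y)%E).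
  apply: ae_ge0_le_integral => //.
  - by move=> y _; rewrite lee_fin subr_ge0; have /andP[_ /ltW ?] := t01 y;
    rewrite (le_trans (ln_le0 _)).
  - apply/measurable_EFinP; apply: measurable_funB => //.
    by apply: (measurableT_comp (f := @ln R)) => //.
  exists (~` [set y | (g <= t y)%R]); split; first exact: measurableC.
    transitivity (1 - P [set y | (g <= t y)%R])%E; first exact: probability_setC.
    by rewrite Pg subee.
  move=> y /=; apply: contra_not => gy _.
  have /andP[t0 t1] := t01 y.
  rewrite /G -EFinM -EFinD lee_fin -addrA lerD2l indicE.
  have [tu|ut] := leP (t y) u.
    rewrite mem_set// mulr1 (le_trans (_ : _ <= - ln g)) ?lerDr//.
    by rewrite lerN2 ler_ln ?posrE.
  rewrite memNset ?mulr0 ?addr0; last by rewrite /= leNgt ut.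
  by apply: le_trans ul; rewrite lerN2 ler_ln ?posrE// ltW.
rewrite ge0_integralD//; last 3 first.
- by move=> y _; rewrite lee_fin addr_ge0.
- by move=> y _; apply: mule_ge0.
- exact: emeasurable_funM.
rewrite ge0_integralZl_EFin// integral_indic// setIT integral_cst//.
rewrite [X in (_ * X + _)%E](_ : _ = 1%E); last exact: probability_setT.
rewrite mule1.
by rewrite [leRHS]EFinD; apply: leeD.
Qed.

Lemma measurable_near_coord n (i : 'I_n) (m : R) :
  measurable [set y : n.-tuple R | `|tnth y i - m| <= sigma].
Proof.
rewrite -[X in measurable X]setTI.
have := @measurable_tnth _ _ n i measurableT _ (@measurable_itv R `[m - sigma, m
  + sigma]).
by congr (measurable (_ `&` _)); apply/seteqP; split => y /=;
  rewrite in_itv/= ler_distl.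
Qed.

(** The mean vectors that witness the lower bound. *)
Definition spike_vec n k (m : R) : n.-tuple R
  := [tuple if (i < k)%N then m else 0 | i < n].

Lemma spike_vec_ell0 n k m : ell0 k (spike_vec n k m).
Proof.
apply: (@leq_trans #|[pred i : 'I_n | (i < k)%N]|).
  apply: subset_leq_card; apply/fintype.subsetP => i; rewrite !inE tnth_mktuple.
  by case: ifP => //; rewrite eqxx.
rewrite -sum1_card; have [kn|nk] := leqP k n.
  by rewrite (big_ord_narrow kn)/= sum1_card card_ord.
by rewrite sum1_card (leq_trans (max_card _))// card_ord ltnW.
Qed.

(** The length of [m - sigma, m + sigma] times a lower bound of the N(m, sigma^2)
    density there. *)
Definition central_mass : R := 2 * sigma * (normal_peak sigma * expR (-1)).

Lemma central_mass_gt0 : 0 < central_mass.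
Proof. by rewrite !mulr_gt0 ?expR_gt0 ?normal_peak_gt0// gt_eqF. Qed.

(** Where the noise is at most sigma and the scale at most u, a coordinate with mean
    m loses at least (m / 2)^2. The event u < t involves all coordinates, and its
    probability is subtracted in each of them. *)
Lemma risk_lower n k (m : R) (t : n.-tuple R -> R) (u : R) : (k <= n)%N -> 0 <= m ->
  measurable_fun setT t -> (forall y, 0 < t y) ->
  (forall s x, 0 < s -> s <= u -> `|x - m| <= sigma
    -> `|horseshoe_mean sigma s x| <= m / 2) ->
  (normal_vec sigma (spike_vec n k m) [set y | (u < t y)%R]
    <= (central_mass / 2)%:E)%E ->
  ((k%:R * ((m / 2) ^+ 2 * (central_mass / 2)))%:E <=
  'E_(normal_vec sigma (spike_vec n k m))[fun y =>
     (l2norm (vsub (horseshoe_estimator sigma (t y) y) (spike_vec n k m)) ^+ 2)%R])%E.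
Proof.
move=> kn m0 mt t0 hs hA; set theta := spike_vec n k m; set P := normal_vec sigma theta.
pose A := [set y | u < t y].
have mA : measurable A by exact: measurable_gt.
pose B (i : 'I_n) := [set y : n.-tuple R | `|tnth y i - m| <= sigma].
have mB i : measurable (B i) := measurable_near_coord i m.
pose C i := B i `\` A.
have mC i : measurable (C i) by exact: measurableD.
have PC (i : 'I_n) : (i < k)%N -> ((central_mass / 2)%:E <= P (C i))%E.
  move=> ik.
  have PB : (central_mass%:E <= P (B i))%E.
    rewrite (_ : P (B i) = normal_prob m sigma [set x | `|x - m| <= sigma]%R).
      exact: normal_prob_near_mean.
    rewrite /P (@normal_vec_coord R sigma n theta i [set x | `|x - m| <= sigma]).
      by rewrite tnth_mktuple ik.
    rewrite (_ : [set x | _] = `[m - sigma, m + sigma]%classic);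
      first exact: measurable_itv.
    by apply/seteqP; split => y /=; rewrite in_itv/= ler_distl.
  have PBC : (P (B i) <= P (C i) + P A)%E.
    apply: (@le_trans _ _ (P (C i `|` A))).
      apply: le_measure; rewrite ?inE//; first exact: measurableU.
      by move=> y By; have [Ay|nAy] := pselect (A y); [right|left].
    exact: measureU2.
  have fC : P (C i) \is a fin_num by rewrite fin_num_measure.
  move: (le_trans PB (le_trans PBC (leeD2l _ hA))).
  by rewrite -(fineK fC) -EFinD !lee_fin; lra.
have m20 : 0 <= (m / 2) ^+ 2 by exact: sqr_ge0.
rewrite unlock; apply: (@le_trans _ _ (\int[P]_y \sum_(i < n | (i < k)%N) (((m / 2)
  ^+ 2)%:E * (\1_(C i) y)%:E))%E); last first.
  apply: le_integral_dominated => y.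
    by apply: sume_ge0 => i _; apply: mule_ge0.
  rewrite loss_sum -sumEFin big_mkcond/=; apply: lee_sum => i _.
  case: ifPn => ik; last by rewrite lee_fin sqr_ge0.
  rewrite -EFinM lee_fin indicE; have [yC|yC] := boolP (y \in C i); last first.
    by rewrite mulr0 sqr_ge0.
  move/set_mem: yC => -[By nA]; rewrite mulr1 tnth_mktuple ik.
  have := hs (t y) (tnth y i) (t0 y); rewrite leNgt (introF idP nA) => /(_ isT By).
  rewrite ler_norml => /andP[h1 h2].
  rewrite -[leRHS]sqrrN lerXn2r ?nnegrE ?divr_ge0//; lra.
have mI i : measurable_fun setT (fun y => (\1_(C i) y : R)%:E).
  by apply/measurable_EFinP; exact: measurable_indic.
rewrite [leRHS](_ : _ = \sum_(i < n | (i < k)%N) (((m / 2) ^+ 2)%:E * P (C i)))%E;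
  last first.
  under eq_integral do rewrite big_mkcond/=.
  rewrite ge0_integral_sum//; last 2 first.
  - by move=> i; case: (i < k)%N => //; exact: emeasurable_funM.
  - by move=> i y _; case: (i < k)%N => //; exact: mule_ge0.
  rewrite [RHS]big_mkcond; apply: eq_bigr => i _; case: (i < k)%N;
    last exact: integral0.
  by rewrite ge0_integralZl_EFin// integral_indic// setIT.
apply: (@le_trans _ _ (\sum_(i < n | (i < k)%N) ((m / 2) ^+ 2 * (central_mass /
  2))%:E)%E).
  rewrite sumEFin lee_fin (big_ord_narrow kn)/= sumr_const card_ord.
  by rewrite -[leRHS]mulr_natl.
apply: lee_sum => i ik; rewrite EFinM; apply: lee_wpmul2l; first by rewrite lee_fin.
exact: PC.
Qed.
End risk_bounds.

(** * Rates as the dimension grows *)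

Section rates.
Context {R : realType}.

Lemma limn_esup_le_near (u : (\bar R)^nat) (l : \bar R) :
  (\forall n \near \oo, u n <= l)%E -> (limn_esup u <= l)%E.
Proof.
move=> ul; rewrite /limn_esup limf_esupE.
apply: (@le_trans _ _ (ereal_sup [set u n | n in [set n | (u n <= l)%E]])).
  by apply: ereal_inf_lbound; exists [set n | (u n <= l)%E].
by apply: ge_ereal_sup => _ [n /= unl <-].
Qed.

Lemma limn_einf_ge_near (u : (\bar R)^nat) (l : \bar R) :
  (\forall n \near \oo, l <= u n)%E -> (l <= limn_einf u)%E.
Proof.
move=> ul; rewrite /limn_einf leeNr; apply: limn_esup_le_near.
by near=> n; rewrite leeN2; near: n.
Unshelve. all: by end_near. Qed.

Variables (sigma : R) (sigma0 : 0 < sigma).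

(** With z^2 <= 2 sigma^2 L and c tau z at most a multiple of L k / n, the null
    coordinates contribute at most a multiple of k L in total. *)
Lemma plug_in_upper n k (theta : n.-tuple R) (t : n.-tuple R -> R) (c C tau J : R) :
  let L := ln (n%:R / k%:R) in
  (0 < k <= n)%N -> 1 <= L -> 1 <= c -> 0 <= C ->
  expR (- L) <= tau -> tau <= expR (- L) * Num.sqrt L -> c * tau <= expR (-1) ->
  ell0 k theta -> measurable_fun setT t -> (forall y, 0 < t y <= 1) ->
  (\int[normal_vec sigma theta]_y (1 - ln (t y))%:E <= J%:E)%E ->
  (normal_vec sigma theta [set y | (c * tau < t y)%R] <= (C * (k%:R / n%:R))%:E)%E ->
  ('E_(normal_vec sigma theta)[fun y =>
     (l2norm (vsub (horseshoe_estimator sigma (t y) y) theta) ^+ 2)%R] <=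
   (k%:R * (2 * bias_const sigma * J + 16 * sigma ^+ 2) +
    k%:R * L * (2 * c * sigma * null_const sigma + 2 * sigma ^+ 2 * C))%:E)%E.
Proof.
move=> L /andP[k0 kn] L1 c1 C0 eL Le ce thk mt t01 hJ hq.
have N0 := null_const_ge0 sigma.
have n0 : (0 < n)%N by exact: leq_trans kn.
have kR : 0 < k%:R :> R by rewrite ltr0n.
have nR : 0 < n%:R :> R by rewrite ltr0n.
have eE : expR (- L) = k%:R / n%:R.
  by rewrite /L expRN lnK ?posrE ?divr_gt0// invf_div.
have tau0 : 0 < tau by apply: lt_le_trans eL; exact: expR_gt0.
have c0 : 0 < c by lra.
have u0 : 0 < c * tau by exact: mulr_gt0.
apply: le_trans (risk_upper sigma0 thk mt t01 u0 ce hJ hq) _.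
rewrite lee_fin lerD2l; set u := c * tau.
have u1 : u <= 1 by apply: le_trans ce _; rewrite expR_le1; lra.
have lu : - ln u <= L.
  rewrite lerNl -[leLHS]expRK ler_ln ?posrE ?expR_gt0//.
  by apply: le_trans eL _; rewrite /u ler_peMl// ltW.
have L0 : 0 <= L by lra.
have z2 : universal_threshold sigma u ^+ 2 <= 2 * sigma ^+ 2 * L.
  by rewrite universal_threshold_sqr// ler_wpM2l// mulr_ge0// sqr_ge0.
have r0 : 0 <= Num.sqrt L by rewrite sqrtr_ge0.
have rr : Num.sqrt L * Num.sqrt L = L by rewrite -expr2 sqr_sqrtr.
have z1 : universal_threshold sigma u <= 2 * sigma * Num.sqrt L.
  have z0 : 0 <= universal_threshold sigma u by apply: mulr_ge0;
    [exact: ltW|exact: sqrtr_ge0].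
  have r20 : 0 <= 2 * sigma * Num.sqrt L by apply: mulr_ge0 => //;
    apply: mulr_ge0 => //; exact: ltW.
  rewrite -ler_sqr ?nnegrE//; apply: le_trans z2 _.
  rewrite exprMn exprMn expr2 sqr_sqrtr//; have := mulr_ge0 (sqr_ge0 sigma) L0; lra.
have uz : u * universal_threshold sigma u <= 2 * c * sigma * L * (k%:R / n%:R).
  apply: (@le_trans _ _ (c * (expR (- L) * Num.sqrt L) * (2 * sigma * Num.sqrt L))).
    apply: ler_pM => //; [exact: ltW| |by rewrite /u ler_pM2l].
    by apply: mulr_ge0; [exact: ltW|exact: sqrtr_ge0].
  rewrite eE -[X in _ <= _ * X * _]rr le_eqVlt; apply/orP; left; apply/eqP; ring.
have h1 := ler_wpM2l N0 uz.
have h2 : universal_threshold sigma u ^+ 2 * (C * (k%:R / n%:R))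
  <= 2 * sigma ^+ 2 * L * (C * (k%:R / n%:R)).
  by apply: ler_wpM2r => //; apply: mulr_ge0 => //; apply: divr_ge0; exact: ltW.
apply: le_trans (ler_wpM2l (ltW nR) (lerD h1 h2)) _.
rewrite le_eqVlt; apply/orP; left; apply/eqP; field; rewrite gt_eqF//.
Qed.

Section sequences.
Variables (p : nat -> nat).
Hypothesis p_bounds : forall n : nat, (0 < n)%N -> (1 <= p n <= n)%N.
Hypothesis p_sparse : ((p n)%:R / n%:R : R) @[n --> \oo] --> (0 : R).
Let L n : R := ln (n%:R / (p n)%:R).

Let expL n : (0 < n)%N -> expR (- L n) = (p n)%:R / n%:R.
Proof.
move=> n0; have /andP[p1 pn] := p_bounds n0.
by rewrite /L expRN lnK ?posrE ?divr_gt0 ?ltr0n// invf_div.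
Qed.

Lemma near_log_ratio (M : R) : \forall n \near \oo, (0 < n)%N /\ M <= L n.
Proof.
have h : \forall n \near \oo, `|(p n)%:R / n%:R : R| < expR (- M).
  move/cvgr0Pnorm_lt : p_sparse; apply; exact: expR_gt0.
near=> n; have n0 : (0 < n)%N by near: n; exact: nbhs_infty_gt.
split => //; have : `|(p n)%:R / n%:R : R| < expR (- M) by near: n.
by rewrite -expL// ger0_norm ?expR_ge0// ltr_expR ltrN2 => /ltW.
Unshelve. all: by end_near. Qed.

Lemma tau_choice_bounds (tau : nat -> R) n :
  tau = tau_ratio p \/ tau = tau_ratio_log p -> (0 < n)%N -> 1 <= L n ->
  expR (- L n) <= tau n /\ tau n <= expR (- L n) * Num.sqrt (L n).
Proof.
move=> htau n0 L1; have r1 : 1 <= Num.sqrt (L n).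
  by rewrite -sqrtr1 ler_sqrt//; lra.
rewrite expL//; have q0 : 0 <= (p n)%:R / n%:R :> R by rewrite divr_ge0.
by case: htau => ->; rewrite /tau_ratio /tau_ratio_log -/(L n) lexx ler_peMr.
Qed.

(** sqrt y <= y <= 2 e^(y / 2), so that c tau <= c e^(-L) sqrt L vanishes as L
    grows. *)
Lemma sqrt_exp_small (c x y : R) : 0 < c -> 1 <= y -> 2 * (x + ln (2 * c)) <= y ->
  c * (expR (- y) * Num.sqrt y) <= expR (- x).
Proof.
move=> c0 y1 h.
have y0 : 0 <= y by lra.
have s1 : Num.sqrt y <= 2 * expR (y / 2).
  apply: (@le_trans _ _ y).
    rewrite -[leRHS]sqr_sqrtr// expr2 ler_peMl ?sqrtr_ge0//.
    by rewrite -sqrtr1 ler_sqrt//; lra.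
  by have := expR_ge1Dx (y / 2); lra.
have -> : expR (- x) = expR (- y) * (expR (y / 2) * (expR (y / 2 - x))).
  by rewrite -!expRD; congr expR; field.
rewrite mulrCA ler_wpM2l ?expR_ge0//.
have s2 : 2 * c <= expR (y / 2 - x).
  rewrite -[leLHS]lnK ?posrE ?mulr_gt0// ler_expR; lra.
apply: (@le_trans _ _ (c * (2 * expR (y / 2)))); first by rewrite ler_wpM2l// ltW.
rewrite (_ : c * _ = expR (y / 2) * (2 * c)); last by ring.
by rewrite ler_wpM2l ?expR_ge0.
Qed.
End sequences.
End rates.

(** * The supremum of the risk over sparse vectors *)

Section sup_risk_bounds.
Context {R : realType}.
Variables (sigma : R) (p : nat -> nat).
Variables (tauhat : forall n : nat, n.-tuple R -> R) (tau : nat -> R).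
Arguments tauhat : clear implicits.
Hypothesis sigma_gt0 : 0 < sigma.
Hypothesis p_bounds : forall n : nat, (0 < n)%N -> (1 <= p n <= n)%N.
Hypothesis p_sparse : ((p n)%:R / n%:R : R) @[n --> \oo] --> (0 : R).
Hypothesis tauhat_measurable : forall n : nat, measurable_fun setT (tauhat n).
Hypothesis tauhat_range : forall (n : nat) (y : n.-tuple R), 0 < tauhat n y < 1.
Arguments tauhat_measurable : clear implicits.
Arguments tauhat_range : clear implicits.
Hypothesis tau_choice : tau = tau_ratio p \/ tau = tau_ratio_log p.
Hypothesis condition1 : overestimation_bound sigma p tauhat tau.
Let L n : R := ln (n%:R / (p n)%:R).

Lemma sup_risk_upper : underestimation_bound sigma p tauhat tau ->
  lesssim (sup_risk sigma p tauhat) (fun n => (p n)%:R * L n).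
Proof.
move=> [g [g01 Pg [C2 C20 h2]]]; have [c [c1 _ [C1 C10 h1]]] := condition1.
have K0 := bias_const_ge0 sigma; have N0 := null_const_ge0 sigma.
pose K := 2 * bias_const sigma * (2 + C2) + 16 * sigma ^+ 2 +
  (2 * c * sigma * null_const sigma + 2 * sigma ^+ 2 * C1).
have M0 : 0 <= 2 * bias_const sigma by apply: mulr_ge0.
have S0 : 0 <= 16 * sigma ^+ 2 by apply: mulr_ge0 => //; exact: sqr_ge0.
have A0 : 0 <= 2 * c * sigma * null_const sigma + 2 * sigma ^+ 2 * C1.
  apply: addr_ge0; apply: mulr_ge0 => //; last exact: ltW.
    by apply: mulr_ge0; [lra|exact: ltW].
  by apply: mulr_ge0 => //; exact: sqr_ge0.
exists (1 + K).
  by rewrite ltr_pwDl// /K; apply: addr_ge0 => //; apply: addr_ge0 => //;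
    apply: mulr_ge0 => //; lra.
near=> n.
have [n0 L1] : (0 < n)%N /\ 1 + `|2 * (1 + ln (2 * c))| <= L n.
  by near: n; exact: near_log_ratio.
have h1n : forall theta, ell0 (p n) theta ->
    (normal_vec sigma theta [set y | (tauhat n y > c * tau n)%R]
      <= (C1 * ((p n)%:R / n%:R))%:E)%E by near: n.
have h2n : forall theta, ell0 (p n) theta ->
    ((- ln (g n (p n)))%:E * normal_vec sigma theta [set y | (tauhat n y
      <= tau n)%R] <= (C2 * L n)%:E)%E by near: n.
have Ln1 : 1 <= L n by apply: le_trans L1; rewrite lerDl.
have [t1 t2] := tau_choice_bounds p_bounds tau_choice n0 Ln1.
have tn0 : 0 < tau n by apply: lt_le_trans t1; exact: expR_gt0.
have c0 : 0 < c by lra.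
have cs : c * tau n <= expR (-1).
  apply: le_trans (sqrt_exp_small (x := 1) c0 Ln1 _); first by rewrite ler_pM2l.
  by apply: le_trans (ler_norm _) _; apply: le_trans L1; rewrite lerDr.
apply: ge_ereal_sup => _ [theta thk <-].
have pn := p_bounds n0.
have lt : - ln (tau n) <= L n.
  by rewrite lerNl -[leLHS]expRK ler_ln ?posrE ?expR_gt0.
have L0 : 0 <= L n by lra.
have J := log_integral_underestimate (tauhat_measurable n) (tauhat_range n) tn0 (g01
  _ _) L0 lt (Pg _ _ n0 thk) (h2n _ thk).
have t01 (y : n.-tuple R) : 0 < tauhat n y <= 1.
  by have /andP[-> /ltW] := tauhat_range n y.
apply: le_trans (plug_in_upper sigma_gt0 pn Ln1 c1 (ltW C10) t1 t2 cs thk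
  (tauhat_measurable n) t01 J (h1n _ thk)) _.
rewrite lee_fin -/(L n); set q := (p n)%:R.
have q0 : 0 <= q :> R by [].
have b1 : 2 * bias_const sigma * (1 + L n + C2 * L n)
  <= 2 * bias_const sigma * ((2 + C2) * L n).
  by apply: ler_wpM2l => //; lra.
have b2 : 16 * sigma ^+ 2 <= 16 * sigma ^+ 2 * L n by rewrite ler_peMr.
apply: (@le_trans _ _ (K * (q * L n))).
  rewrite (_ : K * _ = q * (2 * bias_const sigma * ((2 + C2) * L n)
    + 16 * sigma ^+ 2 * L n) +
    q * L n * (2 * c * sigma * null_const sigma + 2 * sigma ^+ 2 * C1));
      last by rewrite /K; ring.
  by rewrite lerD2r ler_wpM2l// lerD.
by rewrite ler_wpM2r ?mulr_ge0// lerDr.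
Unshelve. all: by end_near. Qed.

(** Truncation from below at 1 / n bounds log (1 / tau) by log n, and it does not
    affect the event of overestimation since 1 / n <= p_n / n <= c tau. *)
Lemma sup_risk_truncated_upper :
  lesssim (sup_risk sigma p (fun n y => Num.max (n%:R^-1) (tauhat n y)))
    (fun n => (p n)%:R * ln n%:R).
Proof.
have [c [c1 _ [C1 C10 h1]]] := condition1.
have K0 := bias_const_ge0 sigma; have N0 := null_const_ge0 sigma.
pose K := 2 * bias_const sigma * 2 + 16 * sigma ^+ 2 +
  (2 * c * sigma * null_const sigma + 2 * sigma ^+ 2 * C1).
have M0 : 0 <= 2 * bias_const sigma by apply: mulr_ge0.
have S0 : 0 <= 16 * sigma ^+ 2 by apply: mulr_ge0 => //; exact: sqr_ge0.
have A0 : 0 <= 2 * c * sigma * null_const sigma + 2 * sigma ^+ 2 * C1.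
  apply: addr_ge0; apply: mulr_ge0 => //; last exact: ltW.
    by apply: mulr_ge0; [lra|exact: ltW].
  by apply: mulr_ge0 => //; exact: sqr_ge0.
exists (1 + K).
  by rewrite ltr_pwDl// /K; apply: addr_ge0 => //; apply: addr_ge0 => //;
    apply: mulr_ge0 => //; lra.
near=> n.
have [n0 L1] : (0 < n)%N /\ 1 + `|2 * (1 + ln (2 * c))| <= L n.
  by near: n; exact: near_log_ratio.
have h1n : forall theta, ell0 (p n) theta ->
    (normal_vec sigma theta [set y | (tauhat n y > c * tau n)%R]
      <= (C1 * ((p n)%:R / n%:R))%:E)%E by near: n.
have Ln1 : 1 <= L n by apply: le_trans L1; rewrite lerDl.
have [t1 t2] := tau_choice_bounds p_bounds tau_choice n0 Ln1.
have tn0 : 0 < tau n by apply: lt_le_trans t1; exact: expR_gt0.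
have c0 : 0 < c by lra.
have cs : c * tau n <= expR (-1).
  apply: le_trans (sqrt_exp_small (x := 1) c0 Ln1 _); first by rewrite ler_pM2l.
  by apply: le_trans (ler_norm _) _; apply: le_trans L1; rewrite lerDr.
apply: ge_ereal_sup => _ [theta thk <-].
have pn := p_bounds n0; have /andP[p1 _] := pn.
have nR : 0 < n%:R :> R by rewrite ltr0n.
have pR : 1 <= (p n)%:R :> R by rewrite ler1n.
have Lln : L n <= ln n%:R.
  rewrite /L ler_ln ?posrE ?divr_gt0//; last lra.
  by rewrite ler_pdivrMr ?ler_peMr//; lra.
pose t (y : n.-tuple R) := Num.max n%:R^-1 (tauhat n y).
have mt : measurable_fun setT t by apply: measurable_maxr => //;
  exact: (tauhat_measurable n).
have t01 (y : n.-tuple R) : 0 < t y <= 1.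
  rewrite /t lt_max invr_gt0 nR/= ge_max invf_le1// ler1n n0/=.
  by have /andP[_ /ltW] := tauhat_range n y.
have J : (\int[normal_vec sigma theta]_y (1 - ln (t y))%:E <= (1 + ln n%:R)%:E)%E.
  apply: (@le_trans _ _ (\int[normal_vec sigma theta]_y cst (1 + ln n%:R)%:E y)%E).
    apply: le_integral_dominated => y; have /andP[ty0 ty1] := t01 y.
      by rewrite lee_fin subr_ge0 (le_trans (ln_le0 _)).
    rewrite lee_fin lerD2l lerNl -lnV ?posrE// ler_ln ?posrE ?invr_gt0//.
    by rewrite /t le_max lexx.
  by rewrite integral_cst// [X in (_ * X <= _)%E](_ : _ = 1%E) ?mule1//;
    exact: probability_setT.
have nu : n%:R^-1 <= c * tau n.
  apply: (@le_trans _ _ (1 * tau n)); last by rewrite ler_pM2r.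
  rewrite mul1r; apply: le_trans t1; rewrite /L expRN lnK ?posrE ?divr_gt0//; last lra.
  by rewrite invf_div ler_peMl// invr_ge0 ltW.
have hq : (normal_vec sigma theta [set y | (c * tau n < t y)%R]
  <= (C1 * ((p n)%:R / n%:R))%:E)%E.
  rewrite (_ : [set y | _] = [set y | tauhat n y > c * tau n]); first exact: h1n.
  by apply/seteqP; split => y /=; rewrite /t lt_max ltNge nu.
apply: le_trans (plug_in_upper sigma_gt0 pn Ln1 c1 (ltW C10) t1 t2 cs thk mt t01 J
  hq) _.
rewrite lee_fin -/(L n); set q := (p n)%:R; set l := ln n%:R in Lln *.
have q0 : 0 <= q :> R by [].
have l1 : 1 <= l by lra.
have b1 : 2 * bias_const sigma * (1 + l) <= 2 * bias_const sigma * (2 * l).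
  by apply: ler_wpM2l => //; lra.
have b2 : 16 * sigma ^+ 2 <= 16 * sigma ^+ 2 * l by rewrite ler_peMr.
apply: (@le_trans _ _ (K * (q * l))).
  rewrite (_ : K * _ = q * (2 * bias_const sigma * (2 * l) + 16 * sigma ^+ 2 * l) +
    q * l * (2 * c * sigma * null_const sigma + 2 * sigma ^+ 2 * C1));
      last by rewrite /K; ring.
  by rewrite lerD// ?ler_wpM2l ?lerD// ler_wpM2r// ler_wpM2l.
by rewrite ler_wpM2r ?lerDr// mulr_ge0//; lra.
Unshelve. all: by end_near. Qed.

(** With m^2 = sigma^2 L / 4 and |x - m| <= sigma, the exponent x^2 / (2 sigma^2) is
    at most L / 4 + 1, and e^(L / 4) is beaten by c tau <= c e^(-L) sqrt L. *)
Lemma sup_risk_lower : exists2 c : R, 0 < c &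
  \forall n \near \oo, ((c * ((p n)%:R * L n))%:E <= sup_risk sigma p tauhat n)%E.
Proof.
have [c [c1 _ [C1 C10 h1]]] := condition1.
have m0 := central_mass_gt0 sigma_gt0.
have p0 := pi_gt0 R.
exists (sigma ^+ 2 / 16 * (central_mass sigma / 2)).
  by rewrite mulr_gt0 ?divr_gt0 ?exprn_gt0.
have c0 : 0 < c by lra.
near=> n.
have [n0 LM] : (0 < n)%N /\ 1 + `|2 * (1 + ln (2 * c))| + `|4 / 3 * (1
  + ln (16 * pi * c))| + `|ln (2 * C1 / central_mass sigma)| <= L n.
  by near: n; exact: near_log_ratio.
have h1n : forall theta, ell0 (p n) theta ->
    (normal_vec sigma theta [set y | (tauhat n y > c * tau n)%R]
      <= (C1 * ((p n)%:R / n%:R))%:E)%E by near: n.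
have Ln1 : 1 <= L n by apply: le_trans LM; rewrite -!addrA lerDl !addr_ge0.
have L2 : 2 * (1 + ln (2 * c)) <= L n.
  apply: le_trans (ler_norm _) _; apply: le_trans LM;
    rewrite -2!addrA addrCA lerDl !addr_ge0//.
have L3 : 4 / 3 * (1 + ln (16 * pi * c)) <= L n.
  apply: le_trans (ler_norm _) _; apply: le_trans LM; rewrite addrAC lerDr !addr_ge0//.
have L4 : ln (2 * C1 / central_mass sigma) <= L n.
  apply: le_trans (ler_norm _) _; apply: le_trans LM; rewrite lerDr !addr_ge0//.
have [t1 t2] := tau_choice_bounds p_bounds tau_choice n0 Ln1.
have tn0 : 0 < tau n by apply: lt_le_trans t1; exact: expR_gt0.
have cs : c * tau n <= expR (-1).
  by apply: le_trans (sqrt_exp_small (x := 1) c0 Ln1 _); first by rewrite ler_pM2l.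
have cs1 : c * tau n <= 1 by apply: le_trans cs _; rewrite expR_le1; lra.
have /andP[p1 pn] := p_bounds n0.
have nR : 0 < n%:R :> R by rewrite ltr0n.
have pR : 0 < (p n)%:R :> R by rewrite ltr0n.
pose r := Num.sqrt (L n); pose m := sigma / 2 * r.
have r0 : 0 <= r by rewrite sqrtr_ge0.
have r2 : r ^+ 2 = L n by rewrite sqr_sqrtr//; lra.
have mm0 : 0 <= m by rewrite mulr_ge0// divr_ge0// ltW.
have hs (s x : R) : 0 < s -> s <= c * tau n -> `|x - m| <= sigma
  -> `|horseshoe_mean sigma s x| <= m / 2.
  move=> s0 su xm; have s1 : s <= 1 by lra.
  apply: le_trans (horseshoe_mean_shrunk sigma_gt0 s0 s1 x) _.
  have E1 : scaled_abs sigma x ^+ 2 <= L n / 4 + 1.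
    rewrite scaled_abs_sqr ler_pdivrMr ?mulr_gt0 ?exprn_gt0//.
    have -> : (L n / 4 + 1) * (2 * sigma ^+ 2) = 2 * m ^+ 2 + 2 * sigma ^+ 2.
      by rewrite /m exprMn r2; field.
    have x2 : (x - m) ^+ 2 <= sigma ^+ 2.
      by rewrite -[leLHS]ger0_norm ?sqr_ge0// normrX lerXn2r ?nnegrE// ltW.
    by have := sqr_ge0 (x - 2 * m); nra.
  have E2 : expR (scaled_abs sigma x ^+ 2) <= expR (L n / 4 + 1) by rewrite ler_expR.
  have E3 : s <= c * (expR (- L n) * r) by apply: le_trans su _; rewrite ler_pM2l.
  have E4 : 16 * pi * c * expR (- L n) * expR (L n / 4 + 1) <= 1.
    have P0 : 0 < 16 * pi * c by apply: mulr_gt0 => //; exact: mulr_gt0.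
    rewrite -[X in X * _ * _]lnK ?posrE// -!expRD expR_le1; lra.
  have Z0 : 0 <= 4 * pi * sigma by apply: mulr_ge0; [apply: mulr_ge0 => //|];
    exact: ltW.
  apply: (@le_trans _ _ (4 * pi * sigma * (c * (expR (- L n) * r)) * expR (L n / 4
    + 1))).
    by apply: ler_pM; rewrite ?expR_ge0 ?ler_wpM2l//; apply: mulr_ge0 => //; exact: ltW.
  have -> : m / 2 = sigma * r / 4 * 1 by rewrite /m; field.
  rewrite (_ : 4 * pi * sigma * _ * _
    = sigma * r / 4 * (16 * pi * c * expR (- L n) * expR (L n / 4 + 1))); last by field.
  apply: ler_wpM2l => //; apply: divr_ge0 => //; apply: mulr_ge0 => //; exact: ltW.
have hA : (normal_vec sigma (spike_vec n (p n) m) [set y | (c * tau n < tauhat n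
  y)%R] <= (central_mass sigma / 2)%:E)%E.
  apply: le_trans (h1n _ (spike_vec_ell0 n (p n) m)) _; rewrite lee_fin.
  have -> : (p n)%:R / n%:R = expR (- L n).
    by rewrite /L expRN lnK ?posrE ?divr_gt0// invf_div.
  have h : 2 * C1 / central_mass sigma <= expR (L n).
    have q0 : 0 < 2 * C1 / central_mass sigma by rewrite divr_gt0// mulr_gt0.
    by rewrite -[leLHS]lnK ?posrE// ler_expR.
  rewrite ler_pdivrMr// in h.
  by rewrite expRN ler_pdivrMr ?expR_gt0//; lra.
have tpos (y : n.-tuple R) : 0 < tauhat n y by have /andP[] := tauhat_range n y.
have := risk_lower sigma_gt0 pn mm0 (tauhat_measurable n) tpos hs hA.
have -> : (p n)%:R * ((m / 2) ^+ 2 * (central_mass sigma / 2))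
  = sigma ^+ 2 / 16 * (central_mass sigma / 2) * ((p n)%:R * L n).
  by rewrite /m -r2; field.
move=> /le_trans; apply; apply: ereal_sup_ubound; exists (spike_vec n (p n) m) => //.
exact: spike_vec_ell0.
Unshelve. all: by end_near. Qed.
End sup_risk_bounds.

Theorem theorem4p1 (R : realType) (sigma : R) (p : nat -> nat)
    (tauhat : forall n : nat, n.-tuple R -> R) (tau : nat -> R)
    (sigma_gt0 : 0 < sigma)
    (p_bounds : forall n : nat, (0 < n)%N -> (1 <= p n <= n)%N)
    (p_infty : p @ \oo --> \oo)
    (p_sparse : ((p n)%:R / n%:R : R) @[n --> \oo] --> (0 : R))
    (tauhat_measurable : forall n : nat, measurable_fun setT (tauhat n))
    (tauhat_range : forall (n : nat) (y : n.-tuple R), 0 < tauhat n y < 1)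
    (tau_choice : tau = tau_ratio p \/ tau = tau_ratio_log p)
    (condition1 : overestimation_bound sigma p tauhat tau) :
  (underestimation_bound sigma p tauhat tau ->
     asymp (sup_risk sigma p tauhat)
       (fun n => (p n)%:R * ln (n%:R / (p n)%:R))) /\
  lesssim
    (sup_risk sigma p (fun n y => Num.max (n%:R^-1) (tauhat n y)))
    (fun n => (p n)%:R * ln n%:R).
Proof.
split; last exact: sup_risk_truncated_upper condition1.
move=> condition2.
have [C C0 hC] := sup_risk_upper sigma_gt0 p_bounds p_sparse tauhat_measurable
  tauhat_range tau_choice condition1 condition2.
have [c c0 hc] := sup_risk_lower sigma_gt0 p_bounds p_sparse tauhat_measurable
  tauhat_range tau_choice condition1.
have B0 : \forall n \near \oo, 0 < (p n)%:R * ln (n%:R / (p n)%:R) :> R.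
  near=> n.
  have [n0 L1] : (0 < n)%N /\ 1 <= ln (n%:R / (p n)%:R) :> R.
    by near: n; exact: near_log_ratio.
  have /andP[p1 _] := p_bounds _ n0.
  by rewrite mulr_gt0 ?ltr0n//; lra.
split; last 2 first.
- exact: limn_einf_sup.
- apply: (@le_lt_trans _ _ C%:E); last exact: ltry.
  apply: limn_esup_le_near; near=> n.
  have Bn : 0 < (p n)%:R * ln (n%:R / (p n)%:R) :> R by near: n.
  rewrite lee_pdivrMr//; near: n; exact: hC.
apply: (@lt_le_trans _ _ c%:E); first by rewrite lte_fin.
apply: limn_einf_ge_near; near=> n.
have Bn : 0 < (p n)%:R * ln (n%:R / (p n)%:R) :> R by near: n.
rewrite lee_pdivlMr//; near: n; exact: hc.
Unshelve. all: by end_near. Qed.
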